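(* Let $(S_1,\ldots,S_N)$ be an iterated function system of similitudes $S_i\colon\mathbb{R}^d\to\mathbb{R}^d$, with contraction ratios given by $r_i\in(0,1)$, which satisfies the open set condition. Let $F$ be its attractor, let $s$ denote the similarity dimension of $(S_1,\ldots,S_N)$, let $(p_1,\ldots,p_N)$ be a nondegenerate probability vector, and define $$t:=\max_{1\le i\le N}\frac{\log p_i}{\log r_i}.$$ Then (by the arithmetic-geometric mean inequality) $t\ge s$, with equality if and only if $(p_1,\ldots,p_N)=(r_1^s,\ldots,r_N^s)$. Moreover: (1) If the maximum defining $t$ is attained at a unique value of $i\in\{1,\ldots,N\}$, then there exists a constant $C>0$ such that for every starting point $v\in F$ and every $0<\delta<\min_{1\le i\le N}r_i$, $$C^{-1}\delta^{-t}\log\log\left(\frac1\delta\right)\le \mathbb{E}(W_{\delta,v})\le C\,\delta^{-t}\left(\log\log\left(\frac1\delta\right)\right)^2 .$$ (2) If the maximum defining $t$ is not attained at a unique value of $i\in\{1,\ldots,N\}$, then there exists a constant $C>0$ such that for every starting point $v\in F$ and every $0<\delta<\min_{1\le i\le N}r_i$, $$C^{-1}\delta^{-t}\log\left(\frac1\delta\right)\le \mathbb{E}(W_{\delta,v})\le C\,\delta^{-t}\log\left(\frac1\delta\right).$$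
   Context: An iterated function system (IFS) is a tuple $(S_1,\ldots,S_N)$ of contractions of $\mathbb{R}^d$; its attractor is the unique nonempty compact set $F\subseteq\mathbb{R}^d$ with $F=\bigcup_{i=1}^N S_iF$. A map $S_i$ is a similitude with contraction ratio $r_i\in(0,1)$ if $d(S_iu,S_iv)=r_i\,d(u,v)$ for all $u,v\in\mathbb{R}^d$, where $d$ is the standard metric. The IFS satisfies the open set condition (OSC) if there is a nonempty (without loss of generality bounded) open set $U\subset\mathbb{R}^d$ with $\bigcup_{i=1}^N S_iU\subseteq U$ and the sets $S_iU$ pairwise disjoint. The similarity dimension is the unique real $s\ge0$ with $\sum_{i=1}^N r_i^s=1$. A probability vector $(p_1,\ldots,p_N)$ is nondegenerate if $p_i>0$ for all $i$. A subset $X\subseteq F$ is $\delta$-dense in $F$ if for every $z\in F$ there is $x\in X$ with $d(x,z)\le\delta$. For $\delta>0$, $v\in F$ and $\mathbf{i}=i_1i_2\ldots\in\{1,\ldots,N\}^{\mathbb{N}}$, the $\delta$-waiting time is $$W_{\delta,v}(\mathbf{i}):=\inf\{n\ge1:\ \{S_{i_1}v,\,S_{i_2}S_{i_1}v,\ldots,S_{i_n}\cdots S_{i_1}v\}\text{ is }\delta\text{-dense in }F\}$$ (with $\inf\emptyset=+\infty$). $\mathbb{E}(W_{\delta,v})$ is its expectation with respect to the $(p_1,\ldots,p_N)$-Bernoulli (i.i.d. product) measure on $\{1,\ldots,N\}^{\mathbb{N}}$.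
   Formalization: In the upper bound of (1), (log log(1/δ))² is replaced by max(1, (log log(1/δ))²), since the printed bound fails at δ = 1/e when min r_i > 1/e (and as δ → 1/e if min r_i = 1/e); and N ≥ 2 is assumed, since the lower bound of (1) fails for N = 1. *)

(* Defs.v *)
From HB Require Import structures.
From mathcomp Require Import all_boot all_order all_algebra.
From mathcomp Require Import all_classical all_reals all_analysis.
Set Implicit Arguments.
Unset Strict Implicit.
Unset Printing Implicit Defensive.
Import Order.TTheory GRing.Theory Num.Theory.
Import numFieldNormedType.Exports.
Local Open Scope classical_set_scope.
Local Open Scope ring_scope.

(* The library norm on 'rV[R]_d is the sup norm; the standard metric has to be
   written out. Both induce the same topology, so the library's [open] and
   [compact] are the usual ones. *)
Definition eucl_dist (R : realType) (d : nat) (u v : 'rV[R]_d) : R :=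
  Num.sqrt (\sum_(i < d) (u 0 i - v 0 i) ^+ 2).

Definition similitude (R : realType) (d : nat)
    (f : 'rV[R]_d -> 'rV[R]_d) (r : R) : Prop :=
  0 < r < 1 /\ forall u v, eucl_dist (f u) (f v) = r * eucl_dist u v.

Definition open_set_condition (R : realType) (d N : nat)
    (S : 'I_N -> 'rV[R]_d -> 'rV[R]_d) : Prop :=
  exists U : set 'rV[R]_d,
    [/\ U !=set0, open U, \bigcup_i (S i @` U) `<=` U &
        forall i j, i != j -> S i @` U `&` S j @` U = set0].

Definition is_attractor (R : realType) (d N : nat)
    (S : 'I_N -> 'rV[R]_d -> 'rV[R]_d) (F : set 'rV[R]_d) : Prop :=
  [/\ F !=set0, compact F & F = \bigcup_i (S i @` F)].

Definition is_similarity_dimension (R : realType) (N : nat)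
    (r : 'I_N -> R) (s : R) : Prop :=
  0 <= s /\ \sum_(i < N) r i `^ s = 1.

Definition nondegenerate_probability_vector (R : realType) (N : nat)
    (p : 'I_N -> R) : Prop :=
  (forall i, 0 < p i) /\ \sum_(i < N) p i = 1.

(* Indexing by 'I_N.+1 provides a seed for the iterated maximum and minimum. *)
Definition max_of (R : realType) (N : nat) (f : 'I_N.+1 -> R) : R :=
  \big[Num.max/f ord0]_(i < N.+1) f i.

Definition min_of (R : realType) (N : nat) (f : 'I_N.+1 -> R) : R :=
  \big[Num.min/f ord0]_(i < N.+1) f i.

Definition delta_dense (R : realType) (d : nat) (F : set 'rV[R]_d) (delta : R)
    (X : set 'rV[R]_d) : Prop :=
  X `<=` F /\ forall z, F z -> exists2 x, X x & eucl_dist x z <= delta.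

HB.instance Definition _ (N : nat) := isPointed.Build 'I_N.+1 ord0.

(* Codes are indexed from 0: [x k] is the letter usually written i_(k+1). *)
Definition cylinder (N n : nat) (w : nat -> 'I_N.+1) : set (nat -> 'I_N.+1) :=
  [set x | forall k, (k < n)%N -> x k = w k].

Definition cylinders (N : nat) : set (set (nat -> 'I_N.+1)) :=
  [set A | exists n w, A = cylinder n w].

(* The sequence space {1, ..., N+1}^nat with its product sigma-algebra. *)
Notation codeSpace N := (g_sigma_algebraType (@cylinders N)).

(* These values on cylinders determine the measure [P] uniquely. *)
Definition bernoulli_measure (R : realType) (N : nat) (p : 'I_N.+1 -> R)
    (P : probability (codeSpace N) R) : Prop :=
  forall n (w : nat -> 'I_N.+1),
    P (cylinder n w) = (\prod_(k < n) p (w k))%:E.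

(* [chaos_orbit S v x n] is S_(i_n) (... (S_(i_1) v)). *)
Fixpoint chaos_orbit (R : realType) (d N : nat)
    (S : 'I_N.+1 -> 'rV[R]_d -> 'rV[R]_d) (v : 'rV[R]_d)
    (x : nat -> 'I_N.+1) (n : nat) : 'rV[R]_d :=
  if n is m.+1 then S (x m) (chaos_orbit S v x m) else v.

(* The infimum of the empty set is +oo. *)
Definition waiting_time (R : realType) (d N : nat)
    (S : 'I_N.+1 -> 'rV[R]_d -> 'rV[R]_d) (F : set 'rV[R]_d)
    (delta : R) (v : 'rV[R]_d) (x : nat -> 'I_N.+1) : \bar R :=
  ereal_inf [set (n%:R)%:E | n in [set n : nat | (1 <= n)%N /\
    delta_dense F delta
      [set chaos_orbit S v x k | k in [set k : nat | (1 <= k <= n)%N]]]].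

Definition expected_waiting_time (R : realType) (d N : nat)
    (S : 'I_N.+1 -> 'rV[R]_d -> 'rV[R]_d) (F : set 'rV[R]_d)
    (P : probability (codeSpace N) R) (delta : R) (v : 'rV[R]_d) : \bar R :=
  (\int[P]_x waiting_time S F delta v x)%E.

(* (log log (1/delta))^2, floored at 1. The floor is inactive for
   delta <= exp(-e). It is needed because min r_i may exceed 1/e: the bare square
   vanishes at delta = 1/e and so cannot bound a waiting time, which is >= 1. *)
Definition loglog_sq (R : realType) (delta : R) : R :=
  Num.max 1 (ln (ln delta^-1) ^+ 2).

(* Main.v *)
Require Import Defs.
From mathcomp Require Import all_boot all_order all_algebra.
From mathcomp Require Import all_classical all_reals all_analysis.
From mathcomp Require Import measurable_realfun.
From mathcomp Require Import ring lra zify.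
Import Order.TTheory GRing.Theory Num.Theory.
Import numFieldNormedType.Exports.
Set Implicit Arguments.
Unset Strict Implicit.
Unset Printing Implicit Defensive.
Local Open Scope classical_set_scope.
Local Open Scope ring_scope.

(** The orbit point at time [n] is [S_(i_n) (... (S_(i_1) v))], so it lies in
    the piece [S_w F] as soon as the history, read with its newest letter first,
    begins with the word [w]. Covering [F] at scale [delta] is therefore a
    coupon collector problem: the coupons are the words [w] whose ratio [r_w] is
    of order [delta], and [w] turns up at a given time with probability [p_w].
    Since [p_i >= r_i ^ t], with equality for the letters attaining the maximum
    [t], every such [p_w] is at least of order [delta ^ t]. The rarest coupons
    are the words in the maximizing letters. If there are two of these, there
    are as many rarest words as a power of [1 / delta], and collecting them
    costs a factor [log (1 / delta)]. If there is only one, the words that are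
    rare up to a constant factor have boundedly many other letters, so they
    number a power of [log (1 / delta)] and cost a factor
    [log log (1 / delta)].

    Upper bound. A renewal argument shows that the mean time to see [w] is at
    most a constant over [p_w], however [w] overlaps itself ([sum_missing]), so
    the probability of having missed [w] at time [M] decays exponentially in
    [p_w * M] ([missing_exp]). A union bound over the words of length at most
    [L], of order [log (1 / delta)], then controls the series of the tail
    probabilities after [M] steps. Up to a constant, [p_w] is at least
    [delta ^ t] times the product of the numbers [lam i = p_i * r_i ^ (- t)]
    over the letters of [w]. These are at least [1], so their product is at
    least one plus the sum of the [lam i - 1]; hence the union bound factorizes
    over the letters, and the two cases differ only in the choice of [M]
    ([upper_parameter], [upper_log], [upper_loglog]).

    Lower bound. Nearby pieces may meet, so hitting a small ball centred in
    [S_w F] need not reveal [w]. The open set condition bounds the number of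
    pieces of comparable size near a point, and a maximality argument of Schief
    yields one word [u] such that a visit to the ball of radius [r_(w ++ u)]
    around a point of [S_(w ++ u) F] does force the letters [w], for every [w]
    ([good_word]). It remains to bound from below the time to collect a family
    of words of common length [l] and common probability [q]. The expected fall
    per step of the logarithm of the number of words still unseen is at most
    [2 * q], provided that this number is compared with its value [l] steps
    earlier, with respect to which the newest [l] letters are independent
    ([potential_drift]); so order [log (size A / l) / q] steps are needed
    ([few_unseen]). The families are built by concatenating blocks: words in
    the two blocks [ij] and [ji] when [i] and [j] both attain the maximum, and
    pairs of blocks [i ... i j i ... i] when [i] alone does ([lower_log],
    [lower_loglog]). *)

(** * Sums over words *)

Section WeightedSums.
Context {R : realType} {I : finType}.
Implicit Types (x y : I -> R) (f g : seq I -> R) (w s u : seq I).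

Definition weight x w : R := \prod_(i <- w) x i.

Lemma weight_nil x : weight x [::] = 1.
Proof. by rewrite /weight big_nil. Qed.

Lemma weight_cons x i w : weight x (i :: w) = x i * weight x w.
Proof. by rewrite /weight big_cons. Qed.

Lemma weight_cat x u w : weight x (u ++ w) = weight x u * weight x w.
Proof. by rewrite /weight big_cat. Qed.

Lemma weight_gt0 x w : (forall i, 0 < x i) -> 0 < weight x w.
Proof. by move=> x0; rewrite /weight; apply: prodr_gt0. Qed.

(** Letters are added at the head, so a word is a history with its newest
    letter first, in the order in which [S_(i_n) ... S_(i_1)] names a piece of
    the attractor; when [x] is a probability vector, [wsum x n f] is the
    expectation of [f] over the histories of length [n]. *)
Fixpoint wsum x n f : R :=
  if n is m.+1 then wsum x m (fun s => \sum_i x i * f (i :: s)) else f [::].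

Lemma eq_wsum x n f g : (forall s, size s = n -> f s = g s) ->
  wsum x n f = wsum x n g.
Proof.
elim: n f g => [|n IH] f g fg /=; first exact: fg.
by apply: IH => s sn; apply: eq_bigr => i _; rewrite fg//= sn.
Qed.

Lemma wsumZ x n c f : wsum x n (fun s => c * f s) = c * wsum x n f.
Proof.
elim: n f => [//|n IH] f /=; rewrite -IH; apply: eq_wsum => s _.
by rewrite mulr_sumr; apply: eq_bigr => i _; rewrite mulrCA.
Qed.

Lemma wsumD x n f g : wsum x n (fun s => f s + g s) = wsum x n f + wsum x n g.
Proof.
elim: n f g => [//|n IH] f g /=; rewrite -IH; apply: eq_wsum => s _.
by rewrite -big_split; apply: eq_bigr => i _; rewrite mulrDr.
Qed.

Lemma wsum0 x n : wsum x n (fun=> 0) = 0.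
Proof.
transitivity (wsum x n (fun s => 0 * 0 : R)); first by apply: eq_wsum => s _; rewrite mulr0.
by rewrite wsumZ mul0r.
Qed.

Lemma wsumB x n f g : wsum x n (fun s => f s - g s) = wsum x n f - wsum x n g.
Proof.
rewrite -[- wsum x n g]mulN1r -wsumZ -wsumD.
by apply: eq_wsum => s _; rewrite mulN1r.
Qed.

Lemma wsum_sum x n (J : Type) (r : seq J) (P : pred J) (f : J -> seq I -> R) :
  wsum x n (fun s => \sum_(j <- r | P j) f j s) =
  \sum_(j <- r | P j) wsum x n (f j).
Proof.
elim: r => [|j r IH].
  by rewrite big_nil -[RHS](wsum0 x n); apply: eq_wsum => s _; rewrite big_nil.
rewrite big_cons -IH; case: ifP => Pj; last first.
  by apply: eq_wsum => s _; rewrite big_cons Pj.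
by rewrite -wsumD; apply: eq_wsum => s _; rewrite big_cons Pj.
Qed.

Lemma wsum_cat x n m f :
  wsum x (n + m) f = wsum x m (fun s => wsum x n (fun u => f (u ++ s))).
Proof. by elim: n f => [//|n IH] f /=; rewrite IH. Qed.

Lemma wsum_rcons x n f :
  wsum x n.+1 f = \sum_i x i * wsum x n (fun s => f (rcons s i)).
Proof.
rewrite -addn1 wsum_cat /=; apply: eq_bigr => i _; congr (_ * _).
by apply: eq_wsum => s _; rewrite cats1.
Qed.

Lemma wsum_exchange x y n m (f : seq I -> seq I -> R) :
  wsum x n (fun s => wsum y m (f s)) = wsum y m (fun u => wsum x n (f^~ u)).
Proof.
elim: m f => [//|m IH] f /=; rewrite IH; apply: eq_wsum => s _.
by rewrite wsum_sum; apply: eq_bigr => i _; rewrite wsumZ.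
Qed.

Lemma wsum_weight x y n f :
  wsum x n (fun s => weight y s * f s) = wsum (fun i => x i * y i) n f.
Proof.
elim: n f => [|n IH] f /=; first by rewrite weight_nil mul1r.
rewrite -IH; apply: eq_wsum => s _; rewrite mulr_sumr.
by apply: eq_bigr => i _; rewrite weight_cons; ring.
Qed.

Lemma wsum1 x n : wsum x n (fun=> 1) = (\sum_i x i) ^+ n.
Proof.
elim: n => [//|n IH]; rewrite exprS -IH -wsumZ /=; apply: eq_wsum => s _.
by rewrite mulr1; apply: eq_bigr => i _; rewrite mulr1.
Qed.

Lemma wsum_delta x w f :
  wsum x (size w) (fun s => (s == w)%:R * f s) = weight x w * f w.
Proof.
elim: w f => [|i w IH] f /=; first by rewrite weight_nil.
rewrite weight_cons -mulrA mulrCA -[RHS](IH (fun s => x i * f (i :: s))).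
apply: eq_wsum => s _.
rewrite (bigD1 i) //= big1 ?addr0 => [|j /negPf ji]; last first.
  by rewrite eqseq_cons ji/= mul0r mulr0.
by rewrite eqseq_cons eqxx /=; ring.
Qed.

Section Monotone.
Variable x : I -> R.
Hypothesis x0 : forall i, 0 <= x i.

Lemma le_wsum n f g : (forall s, size s = n -> f s <= g s) ->
  wsum x n f <= wsum x n g.
Proof.
elim: n f g => [|n IH] f g fg /=; first exact: fg.
apply: IH => s sn; apply: ler_sum => i _; apply: ler_wpM2l => //.
by rewrite fg//= sn.
Qed.

Lemma wsum_ge0 n f : (forall s, size s = n -> 0 <= f s) -> 0 <= wsum x n f.
Proof. by move=> f0; rewrite -(wsum0 x n); apply: le_wsum. Qed.

Lemma wsum_ge_term w f : (forall s, 0 <= f s) ->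
  weight x w * f w <= wsum x (size w) f.
Proof.
move=> f0; rewrite -wsum_delta; apply: le_wsum => s _.
by case: eqP => _; rewrite ?mul1r ?mul0r.
Qed.

(** The newest letters are independent of the older ones, and prescribing them
    to be [w] keeps only part of a sum of nonnegative terms. *)
Lemma wsum_ge_cat w n f : (forall s, 0 <= f s) ->
  weight x w * wsum x n (fun s => f (w ++ s)) <= wsum x (size w + n) f.
Proof.
move=> f0; rewrite wsum_cat -wsumZ; apply: le_wsum => s _.
exact: (wsum_ge_term w (f := fun u => f (u ++ s))).
Qed.

End Monotone.
End WeightedSums.

(** * Waiting for one word *)

Section Waiting.
Context {R : realType} {I : finType}.
Variable p : I -> R.
Hypothesis p0 : forall i, 0 <= p i.
Hypothesis p1 : \sum_i p i = 1.
Implicit Types (f g : seq I -> R) (w s u : seq I).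

Lemma expectation_cst n (c : R) : wsum p n (fun=> c) = c.
Proof.
transitivity (wsum p n (fun=> c * 1)); first by apply: eq_wsum => *; rewrite mulr1.
by rewrite wsumZ wsum1 p1 expr1n mulr1.
Qed.

Lemma expectation_drop f k n :
  wsum p (k + n) (fun s => f (drop k s)) = wsum p n f.
Proof.
rewrite wsum_cat; apply: eq_wsum => s _.
rewrite -[RHS](expectation_cst k); apply: eq_wsum => u uk.
by rewrite drop_size_cat.
Qed.

(** An occurrence of [w] in the history is a visit of the orbit to the piece
    coded by [w]. *)
Definition missing w n : R := wsum p n (fun s => (~~ infix w s)%:R).

Lemma missing_ge0 w n : 0 <= missing w n.
Proof. exact: wsum_ge0. Qed.

Lemma missing_le1 w n : missing w n <= 1.
Proof.
rewrite -(expectation_cst n 1); apply: le_wsum => // s _.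
by case: (~~ _) => /=; rewrite ?ler01.
Qed.

(** Occurrences inside disjoint time windows are independent. *)
Lemma missing_add w m n : missing w (m + n) <= missing w m * missing w n.
Proof.
rewrite /missing wsum_cat -wsumZ; apply: le_wsum => // s _.
rewrite mulrC -wsumZ; apply: le_wsum => // u _.
case: (boolP (infix w s)) => [ws|_]; first by rewrite infix_catl// mul0r.
case: (boolP (infix w u)) => [wu|_]; first by rewrite infix_catr// mulr0.
by rewrite mulr1 /=; case: (~~ _) => /=; rewrite ?ler01.
Qed.

Lemma missing_mul w b k : missing w (b * k) <= missing w b ^+ k.
Proof.
elim: k => [|k IH]; first by rewrite muln0 expr0 missing_le1.
rewrite mulnS exprS (le_trans (missing_add _ _ _))//.
by apply: ler_wpM2l => //; exact: missing_ge0.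
Qed.

Lemma missing_anti w n k : missing w (n + k) <= missing w n.
Proof.
rewrite (le_trans (missing_add _ _ _))// ler_piMr ?missing_ge0//.
exact: missing_le1.
Qed.


Let seen w n u := wsum p n (fun s => (infix w (u ++ s))%:R).

Lemma seen_nil w n : seen w n [::] = 1 - missing w n.
Proof.
rewrite -[X in X - _](expectation_cst n) -wsumB; apply: eq_wsum => s _ /=.
by case: infix; rewrite ?subr0 ?subrr.
Qed.

(** If [w] occurs once the letter [i] has arrived, but not before, then its first
    occurrence is at time [n + (size u).+1]; requiring moreover that the newest
    letters be [i :: u] can only lose probability. *)
Lemma seen_cons w n i u :
  weight p (i :: u) * (seen w n (i :: u) - seen w n u) <=
  missing w (n + size u) - missing w (n + (size u).+1).
Proof.
pose f s : R := (infix w s)%:R - (infix w (behead s))%:R.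
have f0 s : 0 <= f s.
  rewrite /f subr_ge0 ler_nat; case: s => [//|j s]; rewrite [behead _]/=.
  case: (boolP (infix w s)) => // ws.
  by have := infix_catl [:: j] ws; rewrite cat1s => ->.
rewrite /seen -wsumB.
apply: (le_trans (wsum_ge_cat p0 (i :: u) n f0)).
have e m : wsum p m (fun s => (infix w s)%:R) = 1 - missing w m by exact: (seen_nil w m).
have d : wsum p (size (i :: u) + n) (fun s => (infix w (behead s))%:R) =
    1 - missing w (n + size u).
  rewrite -e (addnC n) -[RHS](expectation_drop _ 1); apply: eq_wsum => s _.
  by rewrite drop1.
rewrite wsumB d e addnC /= opprB addrCA addrAC subrr add0r.
exact: lexx.
Qed.

(** Renewal argument. If [w] is missing at time [n] and the next [size w] letters
    spell [w], then the first occurrence of [w] ends inside this window. Wherever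
    it ends, the rest of the window still has to be spelled, which costs a factor
    [th] per letter, and for a fixed position in the window the events belonging
    to different [n] are disjoint. The geometric series in [th] bounds
    [weight p w] times the mean waiting time, whatever the self-overlaps of
    [w]. *)
Lemma sum_missing (th : R) w n0 : (forall i, p i <= th) -> th < 1 ->
  weight p w * (\sum_(n < n0) missing w n) <= (1 - th)^-1.
Proof.
move=> pth th1.
have K0 : 0 < (1 - th)^-1 by rewrite invr_gt0 subr_gt0.
(* The word [u] stands for the part of [w] spelled so far; [u = w] is the claim. *)
suff H u : weight p u * (\sum_(n < n0) (seen w n u - seen w n [::])) <= (1 - th)^-1.
  apply: le_trans (H w); rewrite le_eqVlt; apply/orP; left; apply/eqP.
  congr (_ * _); apply: eq_bigr => n _.
  rewrite seen_nil /seen -[X in X - _](_ : wsum p n (fun=> 1) = _).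
    by rewrite expectation_cst; ring.
  by apply: eq_wsum => s _; rewrite prefix_infix.
elim: u => [|i u IH].
  by rewrite weight_nil big1 ?mulr0 ?ltW// => n _; rewrite subrr.
have -> : \sum_(n < n0) (seen w n (i :: u) - seen w n [::]) =
   \sum_(n < n0) (seen w n (i :: u) - seen w n u) +
   \sum_(n < n0) (seen w n u - seen w n [::]).
  by rewrite -big_split; apply: eq_bigr => n _ /=; ring.
rewrite mulrDr.
have h1 : weight p (i :: u) * (\sum_(n < n0) (seen w n (i :: u) - seen w n u)) <= 1.
  rewrite mulr_sumr.
  apply: (@le_trans _ _ (\sum_(0 <= n < n0) (missing w (n + size u) - missing w (n.+1 + size u)))).
    by rewrite big_mkord; apply: ler_sum => n _; rewrite addSn -addnS; exact: seen_cons.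
  have -> : \sum_(0 <= n < n0) (missing w (n + size u) - missing w (n.+1 + size u)) =
    missing w (size u) - missing w (n0 + size u).
    rewrite -[LHS]opprK -sumrN (eq_bigr (fun n => missing w (n.+1 + size u) - missing w (n + size u))).
      by rewrite (telescope_sumr (fun n => missing w (n + size u)))// add0n opprB.
    by move=> n _; rewrite opprB.
  by rewrite lerBlDr; apply: (le_trans (missing_le1 _ _)); rewrite lerDl missing_ge0.
have h2 : weight p (i :: u) * (\sum_(n < n0) (seen w n u - seen w n [::])) <= th / (1 - th).
  rewrite weight_cons -mulrA.
  apply: (@le_trans _ _ (p i / (1 - th))); first exact: ler_wpM2l.
  by rewrite ler_pM2r.
apply: (le_trans (lerD h1 h2)); rewrite le_eqVlt; apply/orP; left; apply/eqP.
have th1' : 1 - th != 0 by rewrite subr_eq0 gt_eqF.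
by field.
Qed.

(** By Markov's inequality for the mean waiting time, [w] is seen with
    probability one half within a number of steps of order [(weight p w)^-1];
    independent windows turn this half-life into exponential decay. *)
Lemma missing_exp (th : R) w n : (forall i, p i <= th) -> th < 1 ->
  0 < weight p w <= 1 ->
  missing w n <= 2 * expR (- (ln 2 * (1 - th) / 3 * weight p w * n%:R)).
Proof.
move=> pth th1 /andP[q0 q1]; set q := weight p w in q0 q1 *.
set L := (1 - th)^-1.
have th0 : 0 <= th.
  case: (pickP (fun i : I => true)) => [i _|I0]; first exact: le_trans (p0 i) (pth i).
  by move: p1; rewrite big_pred0// => /eqP; rewrite eq_sym oner_eq0.
have L1 : 1 <= L by rewrite invf_ge1 ?subr_gt0// lerBlDr lerDl.
have L0 : 0 < L by exact: lt_le_trans L1.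
have x0 : 0 <= 2 * L / q by rewrite divr_ge0// ?mulr_ge0// ltW.
(* A number of steps after which [w] is missing with probability at most 1/2. *)
pose b := (Num.truncn (2 * L / q)).+1.
have bl : 2 * L / q < b%:R by exact: truncnS_gt.
have bu : b%:R <= 3 * L / q.
  have -> : 3 * L / q = 2 * L / q + L / q by ring.
  rewrite /b -natr1; apply: lerD; first by rewrite truncn_le.
  by rewrite ler_pdivlMr// mul1r (le_trans q1).
have b0 : 0 < (b%:R : R) by rewrite ltr0n.
have mb : missing w b <= 2^-1.
  rewrite -(ler_pM2l (x := q * b%:R)) ?mulr_gt0//.
  apply: (@le_trans _ _ L).
    apply: le_trans (sum_missing w b pth th1); rewrite -/q -mulrA ler_pM2l//.
    rewrite mulr_natl -[X in _ *+ X]card_ord -sumr_const.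
    apply: ler_sum => i _; have := missing_anti w i (b - i).
    by rewrite subnKC// ltnW.
  by move: bl; rewrite ltr_pdivrMr// => /ltW; rewrite ler_pdivlMr// mulrC (mulrC q).
pose k := (n %/ b)%N.
have mk : missing w n <= 2^-1 ^+ k.
  rewrite (divn_eq n b) mulnC (le_trans (missing_anti _ _ _))//.
  by rewrite (le_trans (missing_mul _ _ _))// lerXn2r// ?nnegrE ?missing_ge0.
apply: (le_trans mk).
have -> : 2^-1 ^+ k = 2 * expR (- (ln 2 * k.+1%:R)) :> R.
  rewrite (_ : - _ = k.+1%:R * - ln 2); last by ring.
  by rewrite expRM_natl expRN lnK ?posrE// exprS mulrA divff// mul1r.
rewrite ler_pM2l// ler_expR lerN2 -!mulrA ler_pM2l ?ln_gt0 ?ltr1n//.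
have nb : n%:R <= (b%:R * k.+1%:R : R).
  by rewrite -natrM ler_nat mulnC ltnW// ltn_ceil.
apply: (@le_trans _ _ ((1 - th) * (3^-1 * (q * (3 * L / q * k.+1%:R))))).
  have t0 : 0 < 1 - th by rewrite subr_gt0.
  rewrite !ler_pM2l ?invr_gt0//.
  by apply: (le_trans nb); rewrite ler_pM2r// ltr0n.
rewrite le_eqVlt; apply/orP; left; apply/eqP; rewrite /L.
by field; rewrite subr_eq0 !gt_eqF.
Qed.

Lemma sum_missing_tail (th : R) w M n0 : (forall i, p i <= th) -> th < 1 ->
  weight p w * (\sum_(n < n0) missing w (M + n)) <= missing w M * (1 - th)^-1.
Proof.
move=> pth th1; apply: le_trans (ler_wpM2l (missing_ge0 _ _) (sum_missing w n0 pth th1)).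
rewrite mulrCA; apply: ler_wpM2l; first by rewrite /weight prodr_ge0.
by rewrite mulr_sumr; apply: ler_sum => n _; exact: missing_add.
Qed.

End Waiting.

(** * Waiting for all words of a family *)

Section Cover.
Context {R : realType} {I : finType}.
Variables (p : I -> R) (A : seq (seq I)) (l : nat) (q : R).
Hypothesis p0 : forall i, 0 <= p i.
Hypothesis p1 : \sum_i p i = 1.
Hypothesis Auniq : uniq A.
Hypothesis Asize : {in A, forall w, size w = l}.
Hypothesis Aweight : {in A, forall w, weight p w <= q}.
Hypothesis l0 : (0 < l)%N.
Hypothesis q0 : 0 <= q.
Implicit Types (w s u : seq I).

Definition unseen s := count (fun w => ~~ infix w s) A.

Lemma unseen_le s : (unseen s <= size A)%N.
Proof. exact: count_size. Qed.

(** A new letter can complete only the word spelled by the newest [l] letters. *)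
Lemma unseen_cons i s :
  (unseen s <= unseen (i :: s) +
    ((take l (i :: s) \in A) && ~~ infix (take l (i :: s)) s))%N.
Proof.
set T := take l (i :: s).
apply: (@leq_trans (count (fun w => ~~ infix w (i :: s)) A +
   count (fun w => (w == T) && ~~ infix w s) A)).
  rewrite -count_predUI; apply: leq_trans (leq_addr _ _).
  rewrite /unseen -!size_filter.
  apply: uniq_leq_size; first exact: filter_uniq.
  move=> w; rewrite !mem_filter => /andP[ws wA]; rewrite wA andbT.
  change (~~ infix w (i :: s) || (w == T) && ~~ infix w s).
  rewrite ws andbT; case: (boolP (infix w (i :: s))) => //= wis; move: wis.
  rewrite -[_ || _]/(infix w (i :: s)) infix_consl (negPf ws) orbF.
  by rewrite prefixE (Asize wA) => /eqP <-; rewrite eqxx.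
rewrite /unseen leq_add2l.
case: (boolP (infix T s)) => Ts /=.
  rewrite andbF leqn0; apply/eqP; apply/eqP; rewrite -leqn0 leqNgt -has_count.
  by apply/hasPn => w _; rewrite negb_and negbK; case: eqP => //= ->.
rewrite andbT -(count_uniq_mem _ Auniq).
by apply: sub_count => w /= /andP[].
Qed.

Lemma unseen_cat u s : (unseen s <= unseen (u ++ s) + size u)%N.
Proof.
elim: u => [|i u IH] /=; first by rewrite addn0.
apply: (leq_trans IH); rewrite addnS -addSn leq_add2r.
apply: (leq_trans (unseen_cons i _)); rewrite -addn1 leq_add2l.
by case: (_ && _).
Qed.

(** The logarithm is flattened below [2 * l] so that, where it can fall, moving
    [l] steps back in time at most doubles the number of unseen words. *)
Definition potential n : R := ln (maxn n (2 * l))%:R.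

Let l2 : (0 < 2 * l)%N. Proof. by rewrite muln_gt0 l0. Qed.

Lemma potential_mono m n : (m <= n)%N -> potential m <= potential n.
Proof.
move=> mn; rewrite /potential ler_ln ?posrE ?ltr0n ?leq_max ?l2 ?orbT//.
by rewrite ler_nat geq_max !leq_max mn leqnn orbT.
Qed.

(** When the newest [l] letters complete a new word, the logarithm of the number
    [z] of words left falls by at most [1 / z], and [l] steps earlier at most
    [z + l <= 2 * z] words were unseen. *)
Lemma potential_step i s :
  potential (unseen s) - potential (unseen (i :: s)) <=
  ((take l (i :: s) \in A) && ~~ infix (take l (i :: s)) (drop l (i :: s)))%:R *
    (2 / (unseen (drop l (i :: s)))%:R).
Proof.
set T := take _ _; set s0 := drop _ _; have := unseen_cons i s; rewrite -/T.
case: (boolP (_ && _)) => [/andP[TA Ts]|_]; last first.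
  rewrite addn0 => /potential_mono h.
  by rewrite (le_trans (y := 0)) ?subr_le0// mulr_ge0// ?divr_ge0.
rewrite addn1 => /potential_mono h.
have Ts0 : ~~ infix T s0.
  apply: contra Ts => Ts; rewrite (_ : s = take l.-1 s ++ s0) ?infix_catl//.
  by rewrite /s0; case: (l) l0 => //= k _; rewrite cat_take_drop.
rewrite TA Ts0 /= mul1r.
set z := unseen (i :: s) in h *.
have [zl|zl] := leqP z.+1 (2 * l).
  rewrite (le_trans (y := 0))//.
  rewrite subr_le0; apply: (le_trans h).
  by rewrite /potential (maxn_idPr zl) (maxn_idPr (ltnW zl)).
have z0 : (0 < z)%N by rewrite (leq_trans l2).
have z0R : 0 < z%:R :> R by rewrite ltr0n.
have u0 : (0 < unseen s0)%N by rewrite -has_count; apply/hasP; exists T.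
have zs0 : (unseen s0 <= 2 * z)%N.
  have := unseen_cat (take l (i :: s)) s0; rewrite cat_take_drop (Asize TA) -/z.
  by move=> /leq_trans; apply; rewrite mul2n -addnn leq_add2l; lia.
apply: (@le_trans _ _ (z%:R^-1)); last first.
  rewrite ler_pdivlMr ?ltr0n// mulrC ler_pdivrMr// -natrM ler_nat.
  exact: zs0.
rewrite lerBlDr; apply: (le_trans h).
have zl' : (2 * l <= z)%N by exact: zl.
rewrite /potential (maxn_idPl (ltnW zl)) (maxn_idPl zl').
rewrite -lerBlDr -ln_div ?posrE ?ltr0n//.
have -> : z.+1%:R / z%:R = 1 + z%:R^-1 :> R.
  by rewrite -natr1 mulrDl divff ?gt_eqF// mul1r.
apply: le_ln1Dx; apply: (@lt_le_trans _ _ 0); first by rewrite ltrN10.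
by rewrite invr_ge0 ltW.
Qed.

(** The newest [l] letters are independent of the history [s0] before them, so
    each word unseen in [s0] is completed with probability at most [q], and then
    costs [2 / unseen s0]; summing over these words gives [2 * q]. *)
Lemma potential_drift n :
  wsum p n (fun s => potential (unseen s)) - 2 * q <=
  wsum p n.+1 (fun s => potential (unseen s)).
Proof.
rewrite lerBlDr -lerBlDl.
rewrite -(expectation_drop p1 _ 1) add1n -wsumB.
pose g s : R := ((take l s \in A) && ~~ infix (take l s) (drop l s))%:R *
   (2 / (unseen (drop l s))%:R).
apply: (@le_trans _ _ (wsum p n.+1 g)).
  apply: le_wsum => // -[//|i s] _; rewrite drop1; exact: potential_step.
have [nl|ln] := ltnP n.+1 l.
  rewrite (eq_wsum p (g := fun=> 0)) ?wsum0 ?mulr_ge0// => s sn.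
  rewrite /g; case: (boolP (take l s \in A)) => [/Asize|_]; last by rewrite mul0r.
  by rewrite size_take sn ltnNge (ltnW nl) /= => nl'; rewrite nl' ltnn in nl.
rewrite -(subnKC ln) wsum_cat -[X in _ <= X](expectation_cst p1 (n.+1 - l)).
apply: le_wsum => // s0 _.
have [Z0|Z0] := posnP (unseen s0).
  rewrite (eq_wsum p (g := fun=> 0)) ?wsum0 ?mulr_ge0// => u ul.
  by rewrite /g drop_size_cat// Z0 invr0 !mulr0.
rewrite (eq_wsum p (g := fun u => \sum_(w <- A) (~~ infix w s0)%:R * (2 / (unseen s0)%:R) * ((u == w)%:R * 1))); last first.
  move=> u ul; rewrite /g drop_size_cat// take_size_cat//.
  case: (boolP (u \in A)) => [uA|uA]; last first.
    rewrite mul0r big1_seq// => w /andP[_ wA]; case: eqP => [uw|_].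
      by move: uA; rewrite uw wA.
    by rewrite mul0r mulr0.
  rewrite (bigD1_seq u)//= eqxx !mulr1 big1 ?addr0// => w wu.
  by rewrite eq_sym (negPf wu) mul0r mulr0.
rewrite wsum_sum.
apply: (@le_trans _ _ (\sum_(w <- A) (~~ infix w s0)%:R * (2 / (unseen s0)%:R) * q)).
  rewrite !big_seq; apply: ler_sum => w wA.
  rewrite wsumZ; apply: ler_wpM2l; first by rewrite mulr_ge0// divr_ge0.
  by rewrite -[X in wsum _ X](Asize wA) wsum_delta mulr1 Aweight.
have e : \sum_(w <- A) (~~ infix w s0)%:R = (unseen s0)%:R :> R.
  rewrite /unseen -sum1_count [in RHS]big_mkcond natr_sum.
  by apply: eq_bigr => w _; case: infix.
rewrite -!mulr_suml e mulrCA divff ?mulr1 ?pnatr_eq0 -?lt0n//.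
Qed.

Lemma potential_drop m :
  potential (size A) - 2 * q * m%:R <=
  wsum p m (fun s => potential (unseen s)).
Proof.
elim: m => [|m IH].
  rewrite mulr0 subr0 /=; apply: potential_mono.
  rewrite /unseen leq_eqVlt; apply/orP; left; rewrite eq_sym.
  rewrite -all_count; apply/allP => w wA.
  by rewrite infixs0 -size_eq0 Asize// -lt0n.
apply: le_trans (potential_drift m).
rewrite lerBrDr (le_trans _ IH)// -natr1; lra.
Qed.

(** To leave at most [l] words unseen the potential must have fallen by
    [ln (size A / (2 * l))], while its expected fall by time [m] is at most
    [2 * q * m]. *)
Lemma few_unseen m : (2 * l <= size A)%N ->
  wsum p m (fun s => (unseen s <= l)%N%:R) *
    ln ((size A)%:R / (2 * l)%:R) <= 2 * q * m%:R.
Proof.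
move=> lA; have A0 : (0 < size A)%N by exact: leq_trans lA.
set H := ln _.
have eH : potential (size A) = ln (2 * l)%:R + H.
  by rewrite /potential (maxn_idPl lA) /H ln_div ?posrE ?ltr0n// addrC subrK.
have := potential_drop m.
rewrite lerBlDr -lerBlDl => h; apply: le_trans h.
rewrite -[potential (size A)](expectation_cst p1 m) -wsumB mulrC -wsumZ.
apply: le_wsum => // s _; rewrite eH.
have [sl|sl] := leqP (unseen s) l; last first.
  by rewrite mulr0 subr_ge0 -eH potential_mono// unseen_le.
rewrite mulr1 lerBrDr addrC lerD2r.
rewrite /potential (maxn_idPr _)//; lia.
Qed.
End Cover.

(** * Euclidean geometry *)

Section Euclidean.
Context {R : realType} {d : nat}.
Implicit Types (u v w x y : 'rV[R]_d).

Definition dot u v : R := \sum_(i < d) u 0 i * v 0 i.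

Lemma dotC u v : dot u v = dot v u.
Proof. by apply: eq_bigr => i _; rewrite mulrC. Qed.

Lemma dotDl u v w : dot (u + v) w = dot u w + dot v w.
Proof. by rewrite -big_split; apply: eq_bigr => i _; rewrite !mxE mulrDl. Qed.

Lemma dotZl a u v : dot (a *: u) v = a * dot u v.
Proof. by rewrite mulr_sumr; apply: eq_bigr => i _; rewrite !mxE mulrA. Qed.

Lemma dotBl u v w : dot (u - v) w = dot u w - dot v w.
Proof. by rewrite dotDl -scaleN1r dotZl mulN1r. Qed.

Lemma dotBr u v w : dot w (u - v) = dot w u - dot w v.
Proof. by rewrite dotC dotBl !(dotC w). Qed.

Lemma dot_ge0 u : 0 <= dot u u.
Proof. by apply: sumr_ge0 => i _; rewrite -expr2 sqr_ge0. Qed.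

Lemma dot_eq0 u : dot u u = 0 -> u = 0.
Proof.
move=> /eqP; rewrite psumr_eq0 => [/allP u0|i _]; last by rewrite -expr2 sqr_ge0.
apply/rowP => i; rewrite !mxE; have := u0 i; rewrite mem_index_enum => /(_ isT).
by rewrite mulf_eq0 orbb => /eqP.
Qed.

Lemma eucl_distE u v : eucl_dist u v = Num.sqrt (dot (u - v) (u - v)).
Proof.
by congr Num.sqrt; apply: eq_bigr => i _; rewrite !mxE expr2.
Qed.

Lemma sqr_eucl_dist u v : eucl_dist u v ^+ 2 = dot (u - v) (u - v).
Proof. by rewrite eucl_distE sqr_sqrtr// dot_ge0. Qed.

Lemma eucl_dist_ge0 u v : 0 <= eucl_dist u v.
Proof. exact: sqrtr_ge0. Qed.

Lemma eucl_distC u v : eucl_dist u v = eucl_dist v u.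
Proof. by congr Num.sqrt; apply: eq_bigr => i _; rewrite -sqrrN opprB. Qed.

Lemma eucl_dist0_eq u v : eucl_dist u v = 0 -> u = v.
Proof.
move=> h; apply/eqP; rewrite -subr_eq0; apply/eqP/dot_eq0.
by rewrite -sqr_eucl_dist h expr0n.
Qed.

Lemma eucl_distxx u : eucl_dist u u = 0.
Proof.
by rewrite eucl_distE subrr /dot big1 ?sqrtr0// => i _; rewrite !mxE mulr0.
Qed.

Lemma cauchy_schwarz u v : dot u v ^+ 2 <= dot u u * dot v v.
Proof.
have [v0|v0] := eqVneq (dot v v) 0.
  rewrite v0 mulr0 (dot_eq0 v0) /dot big1 ?expr0n// => i _.
  by rewrite !mxE mulr0.
have vp : 0 < dot v v by rewrite lt_neqAle eq_sym v0 dot_ge0.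
rewrite -subr_ge0 -(pmulr_rge0 _ vp).
have := dot_ge0 (dot v v *: u - dot u v *: v).
rewrite !(dotBl, dotBr, dotZl) !(dotC _ (_ *: _)) !dotZl (dotC v u).
by move=> h; apply: (le_trans h); rewrite le_eqVlt; apply/orP; left; apply/eqP; ring.
Qed.

Lemma eucl_dist_triangle v u w :
  eucl_dist u w <= eucl_dist u v + eucl_dist v w.
Proof.
rewrite -(ler_sqr (eucl_dist_ge0 _ _)) ?nnegrE ?addr_ge0 ?eucl_dist_ge0//.
rewrite sqrrD !sqr_eucl_dist.
have -> : u - w = (u - v) + (v - w) by rewrite addrA subrK.
have dsq a b : dot (a + b) (a + b) = dot a a + dot a b *+ 2 + dot b b.
  by rewrite dotDl [dot a (a + b)]dotC [dot b (a + b)]dotC !dotDl (dotC b a); ring.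
rewrite dsq lerD2r lerD2l ler_pMn2r//.
apply: (le_trans (ler_norm _)).
rewrite -ler_sqr ?nnegrE ?mulr_ge0 ?eucl_dist_ge0//.
by rewrite real_normK ?num_real// exprMn !sqr_eucl_dist cauchy_schwarz.
Qed.

Lemma coord_le_eucl_dist u v i : `|u 0 i - v 0 i| <= eucl_dist u v.
Proof.
rewrite -sqrtr_sqr ler_wsqrtr// (bigD1 i)//= lerDl.
by apply: sumr_ge0 => j _; exact: sqr_ge0.
Qed.

Lemma eucl_dist_le_coord u v e : (forall i, `|u 0 i - v 0 i| <= e) ->
  eucl_dist u v <= d%:R * e.
Proof.
case: d u v => [|n] u v h.
  by rewrite mul0r /eucl_dist big_ord0 sqrtr0.
have e0 : 0 <= e by apply: le_trans (h 0).
rewrite -[leRHS]ger0_norm ?mulr_ge0// -sqrtr_sqr ler_wsqrtr//.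
apply: (@le_trans _ _ (\sum_(i < n.+1) e ^+ 2)).
  apply: ler_sum => i _; rewrite -[X in X <= _]real_normK ?num_real//.
  by rewrite lerXn2r// nnegrE.
rewrite sumr_const card_ord exprMn -[X in X <= _]mulr_natl ler_wpM2r ?sqr_ge0//.
by rewrite expr2 -natrM ler_nat leq_pmulr.
Qed.

(** A similitude, translated to fix the origin and rescaled, preserves the dot
    product; it is then right multiplication by the matrix of the images of the
    basis vectors, which is orthogonal. *)
Lemma similitude_surj (f : 'rV[R]_d -> 'rV[R]_d) r : similitude f r ->
  forall y, exists x, f x = y.
Proof.
move=> [/andP[r0 _] fr] y.
pose g x := r^-1 *: (f x - f 0).
have g2 x z : dot (g x - g z) (g x - g z) = dot (x - z) (x - z).
  rewrite -scalerBr opprB addrA subrK dotZl dotC dotZl.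
  by rewrite -!sqr_eucl_dist fr exprMn expr2; field; rewrite gt_eqF.
have g0 : g 0 = 0 by rewrite /g subrr scaler0.
have gn x : dot (g x) (g x) = dot x x.
  by have := g2 x 0; rewrite g0 !subr0.
have gd x z : dot (g x) (g z) = dot x z.
  have := g2 x z; rewrite !(dotBl, dotBr) !gn (dotC (g z)) (dotC z); lra.
pose Q := \matrix_(i < d) g (delta_mx 0 i).
have gQ x : g x *m Q^T = x.
  apply/rowP => i; rewrite mxE.
  transitivity (dot (g x) (g (delta_mx 0 i))).
    by apply: eq_bigr => j _; rewrite !mxE.
  rewrite gd /dot (bigD1 i)//= big1 ?addr0 => [|j ji].
    by rewrite mxE !eqxx mulr1.
  by rewrite mxE (negPf ji) andbF mulr0.
have QQ : Q *m Q^T = 1%:M.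
  apply/row_matrixP => i; rewrite row_mul rowK gQ.
  by apply/rowP => j; rewrite !mxE eqxx eq_sym.
have QQ' : Q^T *m Q = 1%:M := mulmx1C QQ.
have gE x : g x = x *m Q by rewrite -{2}(gQ x) -mulmxA QQ' mulmx1.
exists (r^-1 *: (y - f 0) *m Q^T).
have : g (r^-1 *: (y - f 0) *m Q^T) = r^-1 *: (y - f 0).
  by rewrite gE -mulmxA QQ' mulmx1.
move=> /(congr1 (fun z => r *: z)).
by rewrite /g !scalerA divff ?gt_eqF// !scale1r => /addIr.
Qed.

(** Grid pigeonhole: two points in one cell of a grid with sides [e / d.+1] are
    closer than [e], and boundedly many cells meet the ball. *)
Lemma separated_bounded (b e : R) : 0 < e -> 0 <= b ->
  exists m : nat, forall (l : seq 'rV[R]_d) (x : 'rV[R]_d), uniq l ->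
    {in l, forall y, eucl_dist x y <= b} ->
    {in l &, forall y z, y != z -> e <= eucl_dist y z} ->
  (size l <= m)%N.
Proof.
move=> e0 b0; pose K : R := d.+1%:R / e.
have K0 : 0 < K by rewrite divr_gt0.
pose M := (Num.truncn (2 * b * K)).+1.
exists (M ^ d)%N => l x ul lb le.
pose cell y : {ffun 'I_d -> 'I_M} :=
  [ffun i => inord (Num.truncn ((y 0 i - x 0 i + b) * K))].
have cellP y z : y \in l -> z \in l -> cell y = cell z -> y = z.
  move=> yl zl yz; apply/eqP; apply: contraT => /(le _ _ yl zl) h.
  have bnd t i : t \in l -> 0 <= (t 0 i - x 0 i + b) * K <= 2 * b * K.
    move=> /lb tb; have := le_trans (coord_le_eucl_dist x t i) tb.
    rewrite ler_norml => /andP[h1 h2]; apply/andP; split.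
      by rewrite mulr_ge0 ?(ltW K0)//; lra.
    by rewrite ler_wpM2r ?(ltW K0)//; lra.
  suff : eucl_dist y z <= d%:R * K^-1.
    move=> /(le_trans h); rewrite /K invf_div mulrA ler_pdivlMr// mulrC.
    by rewrite ler_pM2r// ler_nat ltnn.
  apply: eucl_dist_le_coord => i.
  have := congr1 (fun g : {ffun 'I_d -> 'I_M} => nat_of_ord (g i)) yz.
  have [/andP[y0 yb] /andP[z0 zb]] := (bnd y i yl, bnd z i zl).
  rewrite !ffunE !inordK ?ltnS ?le_truncn// => tyz.
  have /andP[y1 y2] := truncn_itv y0.
  have /andP[z1 z2] := truncn_itv z0.
  rewrite tyz in y1 y2.
  rewrite -(ler_pM2r K0) mulVf ?gt_eqF//.
  rewrite -[X in _ * X]gtr0_norm// -normrM ler_norml.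
  rewrite mulrBl.
  move: y1 y2 z1 z2; rewrite !mulrDl -natr1; lra.
have ul' : uniq (map cell l).
  by rewrite map_inj_in_uniq// => y z; exact: cellP.
rewrite -(size_map cell).
have -> : (M ^ d)%N = #|{ffun 'I_d -> 'I_M}| by rewrite card_ffun !card_ord.
by rewrite -(card_uniqP ul') max_card.
Qed.

End Euclidean.

(** * Pieces of the attractor and the open set condition *)

Lemma compact_eucl_bounded (R : realType) d (F : set 'rV[R]_d) : compact F ->
  exists2 D : R, 1 <= D & forall x y, F x -> F y -> eucl_dist x y <= D.
Proof.
move=> Fc.
have coordb i : exists M : R, forall x, F x -> `|x 0 i| <= M.
  have : compact ((fun x : 'rV[R]_d => x 0 i) @` F).
    by apply: continuous_compact => //; apply: continuous_subspaceT; exact: coord_continuous.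
  move=> /compact_bounded [M [_ hM]].
  by exists (M + 1) => x Fx; apply: (hM (M + 1)); [rewrite ltrDl|exists x].
have [M hM] := choice coordb.
pose B := 1 + \sum_i `|M i|.
exists (1 + d%:R * (2 * B)) => [|x y Fx Fy].
  by rewrite lerDl !mulr_ge0// addr_ge0// sumr_ge0.
apply: (@le_trans _ _ (d%:R * (2 * B))); last by rewrite lerDr.
apply: eucl_dist_le_coord => i.
have hB z : F z -> `|z 0 i| <= B.
  move=> Fz; apply: (le_trans (hM i z Fz)); apply: (le_trans (ler_norm _)).
  rewrite /B (bigD1 i)//= addrCA lerDl addr_ge0// sumr_ge0//.
apply: (le_trans (ler_normB _ _)).
by rewrite mulr_natl mulr2n lerD// hB.
Qed.

Section Stopping.
Context {R : realType} {I : eqType}.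
Variable r : I -> R.
Implicit Types (rho : R) (v w : seq I).

(** The words at which a code stops, being the first prefix with contraction ratio
    at most [rho]. Removing the first letter [i] rescales the picture by
    [r i]. *)
Fixpoint stopping rho w : bool :=
  if w is i :: w' then (rho < 1) && stopping (rho / r i) w' else 1 <= rho.

Lemma stopping_ge1 rho w : stopping rho w -> 1 <= rho -> w = [::].
Proof. by case: w => //= i w /andP[h _]; rewrite leNgt h. Qed.

Lemma stopping_incomparable rho v w : stopping rho v -> stopping rho w -> v != w ->
  exists c i j a b, [/\ v = c ++ i :: a, w = c ++ j :: b & i != j].
Proof.
elim: v w rho => [|i v IH] [|j w] rho //=.
- by move=> h /andP[]; rewrite ltNge h.
- by move=> /andP[]; rewrite ltNge => /negPf ->.
move=> /andP[_ vc] /andP[_ wc]; have [ij|ij] := eqVneq i j.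
  rewrite -ij eqseq_cons eqxx /= in wc * => vw.
  have [c [i' [j' [a [b [-> -> ij']]]]]] := IH _ _ vc wc vw.
  by exists (i :: c), i', j', a, b.
by move=> _; exists [::], i, j, v, w.
Qed.
End Stopping.

Section IFS.
Context {R : realType} {d N : nat}.
Notation I := 'I_N.+1.
Variables (S : I -> 'rV[R]_d -> 'rV[R]_d) (r : I -> R) (F : set 'rV[R]_d).
Hypothesis hS : forall i, similitude (S i) (r i).
Hypothesis hF : is_attractor S F.
Implicit Types (rho : R) (v w s u : seq I).

Let r01 i : 0 < r i < 1. Proof. by have [] := hS i. Qed.
Let r0 i : 0 < r i. Proof. by have /andP[] := r01 i. Qed.

Definition rmin : R := \big[Num.min/1]_i r i.
Definition rmax : R := \big[Num.max/0]_i r i.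

Lemma rmin_le i : rmin <= r i.
Proof. exact: bigmin_le_cond. Qed.

Lemma rmin_le1 : rmin <= 1.
Proof. by apply: (le_trans (rmin_le ord0)); have /andP[_ /ltW] := r01 ord0. Qed.

Lemma rmin_gt0 : 0 < rmin.
Proof. by apply/bigmin_gtP. Qed.

Lemma rmax_ge i : r i <= rmax.
Proof. exact: le_bigmax_cond. Qed.

Lemma rmax_lt1 : rmax < 1.
Proof. by apply/bigmax_ltP; split => // i _; have /andP[] := r01 i. Qed.

Lemma rmax_gt0 : 0 < rmax.
Proof. exact: lt_le_trans (r0 ord0) (rmax_ge _). Qed.

Let wr0 w : 0 < weight r w. Proof. exact: weight_gt0. Qed.

Lemma weight_le1 w : weight r w <= 1.
Proof.
elim: w => [|i w IH]; first by rewrite weight_nil.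
by rewrite weight_cons mulr_ile1// ltW//; have /andP[] := r01 i.
Qed.

Lemma dist_word w x y :
  eucl_dist (foldr S x w) (foldr S y w) = weight r w * eucl_dist x y.
Proof.
elim: w => [|i w IH] /=; first by rewrite weight_nil mul1r.
by have [_ ->] := hS i; rewrite IH weight_cons mulrA.
Qed.

Lemma word_inj w x y : foldr S x w = foldr S y w -> x = y.
Proof.
move=> h; apply: eucl_dist0_eq; have := dist_word w x y.
by rewrite h eucl_distxx => /esym/eqP; rewrite mulf_eq0 gt_eqF// => /eqP.
Qed.

Lemma word_surj w y : exists x, foldr S x w = y.
Proof.
elim: w y => [|i w IH] y /=; first by exists y.
have [z zy] := similitude_surj (hS i) y; have [x xz] := IH z.
by exists x; rewrite xz.
Qed.

Lemma word_attractor w x : F x -> F (foldr S x w).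
Proof.
move=> Fx; elim: w => //= i w IH.
by have [_ _ ->] := hF; exists i => //; exists (foldr S x w).
Qed.

Lemma stopping_le rho w : stopping r rho w -> weight r w <= rho.
Proof.
elim: w rho => [|i w IH] rho /=; first by rewrite weight_nil.
move=> /andP[_ /IH]; rewrite ler_pdivlMr// mulrC.
by rewrite weight_cons.
Qed.

(** The last letter overshoots the scale [rho] by at most its own ratio. *)
Lemma stopping_ge rho w : rho <= 1 -> stopping r rho w -> rmin * rho <= weight r w.
Proof.
have m0 := rmin_gt0; have m1 := rmin_le1.
elim: w rho => [|i w IH] rho rho1 /=.
  by rewrite weight_nil => rho1'; nra.
move=> /andP[rho1' cw]; rewrite weight_cons.
have [h|h] := leP (rho / r i) 1.
  have := IH _ h cw; rewrite mulrA ler_pdivrMr// => /le_trans; apply.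
  by rewrite mulrC.
rewrite (stopping_ge1 cw (ltW h)) weight_nil mulr1.
by apply: (le_trans _ (rmin_le i)); nra.
Qed.

Lemma stopping_cat rho v w : rho <= 1 -> stopping r rho v ->
  stopping r (weight r w * rho) (w ++ v).
Proof.
move=> rho1 cv; elim: w => [|i w IH] /=; first by rewrite weight_nil mul1r.
rewrite weight_cons -mulrA.
rewrite (_ : _ / r i = weight r w * rho); last by rewrite mulrAC mulfV ?mul1r ?gt_eqF.
rewrite IH andbT; have h : weight r w * rho <= 1.
  by have := weight_le1 w; have := wr0 w => ? ?; nra.
by have := r0 i; have /andP[_] := r01 i => ? ?; nra.
Qed.

Lemma stopping_cover L rho z : F z -> rmax ^+ L <= rho ->
  exists w, [/\ (size w <= L)%N, stopping r rho w & exists2 y, F y & z = foldr S y w].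
Proof.
elim: L rho z => [|L IH] rho z Fz /=.
  by rewrite expr0 => rho1; exists [::]; split => //; exists z.
move=> h; have [rho1|rho1] := leP 1 rho.
  by exists [::]; split => //; exists z.
have := Fz; have [_ _ {1}->] := hF => -[i _ [y Fy yz]].
have [||w [wL cw [x Fx xy]]] := IH (rho / r i) y => //.
  rewrite ler_pdivlMr//; apply: le_trans h; rewrite exprSr.
  by rewrite ler_wpM2l ?exprn_ge0 ?(ltW rmax_gt0)// rmax_ge.
exists (i :: w); split; rewrite //= ?rho1//.
by exists x => //; rewrite -xy.
Qed.

Lemma stopping_cover_ex rho z : 0 < rho -> F z ->
  exists2 w, stopping r rho w & exists2 y, F y & z = foldr S y w.
Proof.
move=> rho0 Fz.
have [L hL] : exists L, rmax ^+ L <= rho.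
  have : (fun n => rmax ^+ n) @ \oo --> (0 : R).
    by apply: cvg_expr; rewrite gtr0_norm ?rmax_gt0// rmax_lt1.
  move=> /cvgrPdist_lt /(_ _ rho0) [L _ hL].
  exists L; have := hL L (leqnn _); rewrite sub0r normrN => /ltW.
  by apply: le_trans; exact: ler_norm.
by have [w [_ cw h]] := stopping_cover Fz hL; exists w.
Qed.

(** A code of the orbit point is the history [s] followed by any code of the
    starting point, so a word read off it is comparable with [s]. *)
Lemma stopping_cover_history rho s (v : 'rV[R]_d) : 0 < rho -> F v ->
  exists w, [/\ stopping r rho w, exists2 y, F y & foldr S v s = foldr S y w &
    prefix w s || prefix s w].
Proof.
elim: s rho => [|i s IH] rho rho0 Fv.
  have [w cw h] := stopping_cover_ex rho0 Fv.
  by exists w; split=> //; rewrite prefix0s orbT.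
have [rho1|rho1] := leP 1 rho.
  exists [::]; split => //; exists (foldr S v (i :: s)) => //.
  exact: word_attractor.
have [||w [cw [y Fy yz] ws]] := IH (rho / r i) => //; first by rewrite divr_gt0.
exists (i :: w); split; rewrite /= ?rho1//.
  by exists y => //; rewrite yz.
by rewrite !eqxx.
Qed.

Hypothesis hOSC : open_set_condition S.

(** Two different stopping words part at some letter, so they map the open set
    [U] to disjoint sets; as similitudes are onto, each of these contains a ball
    around the image of [a] with radius of order [rho]. *)
Lemma osc_separated : exists a : 'rV[R]_d, exists2 eta : R, 0 < eta &
  forall rho v w, rho <= 1 -> stopping r rho v -> stopping r rho w -> v != w ->
    eta * rho <= eucl_dist (foldr S a v) (foldr S a w).
Proof.
have [U [[a Ua] oU SU dU]] := hOSC.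
have /nbhs_ballP[e /= e0 eU] : nbhs a U by exact: open_nbhs_nbhs.
exists a, (rmin * e); first by rewrite mulr_gt0// rmin_gt0.
move=> rho v w rho1 cv cw vw; rewrite leNgt; apply/negP => h.
have SUw u x : U x -> U (foldr S x u).
  move=> Ux; elim: u => //= i u IH; apply: SU.
  by exists i => //; exists (foldr S x u).
have [x xw] := word_surj v (foldr S a w).
have Ux : U x.
  apply: eU; split => // i j; rewrite ord1.
  have : weight r v * eucl_dist a x < weight r v * e.
    rewrite -dist_word xw; apply: (lt_le_trans h).
    by rewrite mulrAC ler_wpM2r ?(ltW e0)// stopping_ge.
  rewrite ltr_pM2l// => /(le_lt_trans (coord_le_eucl_dist a x j)).
  by [].
have [c [i [j [v' [w' [ev ew ij]]]]]] := stopping_incomparable cv cw vw.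
move: xw; rewrite ev ew !foldr_cat /= => /word_inj xw.
have : (S i @` U `&` S j @` U) (S i (foldr S x v')).
  split; first by exists (foldr S x v') => //; exact: SUw.
  by exists (foldr S a w'); [exact: SUw|rewrite xw].
by rewrite dU.
Qed.

(** The images of one point under the words of [l] are separated at the scale
    [rho], and all of them lie within a multiple of [rho] from [y0]. *)
Lemma neighbours_bounded : exists B : nat, forall rho y0 (l : seq (seq I)),
  0 < rho <= 1 -> uniq l ->
  (forall v, v \in l -> stopping r rho v /\
     exists2 y, F y & eucl_dist y0 (foldr S y v) <= rho) ->
  (size l <= B)%N.
Proof.
have [a [eta eta0 sep]] := osc_separated.
have [[x0 Fx0] Fc _] := hF.
have [D D1 hD] := compact_eucl_bounded Fc.
pose b := 1 + (D + eucl_dist x0 a).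
have b0 : 0 <= b by rewrite !addr_ge0 ?eucl_dist_ge0// (le_trans _ D1).
have [B hB] := @separated_bounded R d b eta eta0 b0.
have scale (c : R) (x y : 'rV[R]_d) : 0 <= c ->
    eucl_dist (c *: x) (c *: y) = c * eucl_dist x y.
  move=> c0; rewrite !eucl_distE -scalerBr dotZl dotC dotZl mulrA.
  by rewrite sqrtrM ?mulr_ge0// -expr2 sqrtr_sqr ger0_norm.
exists B => rho y0 l /andP[rho0 rho1] ul hl.
have ri0 : 0 <= rho^-1 by rewrite invr_ge0 ltW.
pose g v := rho^-1 *: foldr S a v.
have gsep : {in l &, forall v w, v != w -> eta <= eucl_dist (g v) (g w)}.
  move=> v w /hl[cv _] /hl[cw _] vw.
  by rewrite scale// mulrC ler_pdivlMr// sep.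
rewrite -(size_map g); apply: (hB _ (rho^-1 *: y0)).
- rewrite map_inj_in_uniq// => v w vl wl gvw; apply/eqP; apply: contraT => vw.
  by have := gsep _ _ vl wl vw; rewrite gvw eucl_distxx leNgt eta0.
- move=> _ /mapP[v /hl[cv [y Fy yv]] ->].
  rewrite scale// mulrC ler_pdivrMr//.
  apply: (le_trans (eucl_dist_triangle (foldr S y v) _ _)).
  rewrite /b mulrDl mul1r lerD// dist_word mulrC.
  apply: ler_pM; rewrite ?eucl_dist_ge0 ?(ltW (wr0 _))// ?stopping_le//.
  by apply: (le_trans (eucl_dist_triangle x0 _ _)); rewrite lerD2r hD.
- move=> _ _ /mapP[v vl ->] /mapP[w wl ->] gvw; apply: gsep => //.
  by apply: contraNneq gvw => ->.
Qed.

(** Schief's argument. Choose [u] with the largest possible number of neighbours,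
    that is, of pieces of its own size that come close to its base point. The
    words [w ++ v], for [v] a neighbour of [u], are neighbours of [w ++ u]; by
    maximality there are no others. *)
Lemma good_word x0 : F x0 -> exists u : seq I, forall w v,
  stopping r (weight r (w ++ u)) v ->
  (exists2 y, F y & eucl_dist (foldr S x0 (w ++ u)) (foldr S y v)
     <= weight r (w ++ u)) ->
  prefix w v.
Proof.
move=> Fx0; have [B hB] := neighbours_bounded.
pose near u v := stopping r (weight r u) v /\
  exists2 y, F y & eucl_dist (foldr S x0 u) (foldr S y v) <= weight r u.
(* [Q n]: some word has at least [n] neighbours. *)
pose Q n := `[< exists u l, [/\ uniq l, size l = n & forall v, v \in l -> near u v] >].
have exQ : exists n, Q n by exists 0%N; apply/asboolP; exists [::], [::].
have QB n : Q n -> (n <= B)%N.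
  move=> /asboolP[u [l [ul <- hl]]]; apply: hB (foldr S x0 u) _ _ ul hl.
  by rewrite wr0 weight_le1.
have [n /asboolP[u [l [ul ln hl]]] nmax] := ex_maxnP exQ QB.
exists u => w v cv hv; apply: contraT => wv.
suff /nmax : Q n.+1 by rewrite ltnn.
apply/asboolP; exists (w ++ u), (v :: map (cat w) l); split.
- rewrite /= map_inj_in_uniq ?ul ?andbT.
    by apply/mapP => -[v' _ vE]; rewrite vE prefix_prefix in wv.
  by move=> ? ? _ _ /eqP; rewrite eqseq_cat// eqxx => /eqP.
- by rewrite /= size_map ln.
move=> v'; rewrite inE => /predU1P[->//|/mapP[{}v' /hl[cv' [y Fy hy]] ->]].
split; first by rewrite weight_cat; apply: stopping_cat => //; exact: weight_le1.
exists y => //; rewrite !foldr_cat dist_word weight_cat.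
by rewrite ler_wpM2l// ltW.
Qed.
End IFS.

(** * The expected waiting time as a series *)

Fixpoint history (N : nat) (x : nat -> 'I_N.+1) n : seq 'I_N.+1 :=
  if n is m.+1 then x m :: history x m else [::].

Lemma size_history N (x : nat -> 'I_N.+1) n : size (history x n) = n.
Proof. by elim: n => //= n ->. Qed.

Lemma drop_history N (x : nat -> 'I_N.+1) n k :
  drop n (history x (n + k)) = history x k.
Proof. by elim: n => [|n IH]; rewrite ?drop0. Qed.

Section Bernoulli.
Context {R : realType} {N : nat}.
Notation I := 'I_N.+1.
Variables (p : I -> R) (P : probability (codeSpace N) R).
Hypothesis hP : bernoulli_measure p P.
Implicit Types (x : nat -> I) (s u : seq I) (E : pred (seq I)).

Lemma history_cylinder s : [set x | history x (size s) = s] =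
  cylinder (size s) (nth ord0 (rev s)).
Proof.
elim: s => [|i s IH]; first by apply/seteqP; split => x //= _ k.
apply/seteqP; split => x /=.
  move=> [xi xs] k; rewrite ltnS leq_eqVlt rev_cons nth_rcons size_rev.
  move=> /predU1P[->|ks]; first by rewrite ltnn eqxx.
  have : [set x | history x (size s) = s] x by [].
  by rewrite IH ks => /(_ k ks).
move=> h; congr (_ :: _).
  by rewrite h// rev_cons nth_rcons size_rev ltnn eqxx.
suff : [set x | history x (size s) = s] x by [].
rewrite IH => k ks; rewrite h ?ltnS ?(ltnW ks)//.
by rewrite rev_cons nth_rcons size_rev ks.
Qed.

(** Induction on the number [n] of letters left free: the next letter splits a
    cylinder into the cylinders one letter longer. *)
Lemma history_event E n s :
  let A := [set x | history x (size s) = s /\ E (history x (size s + n))] in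
  measurable (A : set (codeSpace N)) /\
  P A = (weight p s * wsum p n (fun u => (E (u ++ s))%:R))%:E.
Proof.
elim: n s => [|n IH] s /=.
  rewrite addn0; case: (boolP (E s)) => Es; last first.
    have -> : [set x | history x (size s) = s /\ E (history x (size s))] = set0.
      by apply/seteqP; split => x //= -[->]; apply/negP.
    by split; [exact: measurable0|rewrite measure0 mulr0].
  have -> : [set x | history x (size s) = s /\ E (history x (size s))] =
            cylinder (size s) (nth ord0 (rev s)).
    by rewrite -history_cylinder; apply/seteqP; split => x /= [h] //; rewrite h.
  split; first by apply: sub_sigma_algebra; exists (size s), (nth ord0 (rev s)).
  rewrite hP mulr1 /weight; congr _%:E.
  rewrite (perm_big (rev s)) /=; last by rewrite perm_sym perm_rev.
  by rewrite (big_nth ord0) size_rev big_mkord.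
pose A i := [set x | history x (size (i :: s)) = i :: s /\
                 E (history x (size (i :: s) + n))].
have -> : [set x | history x (size s) = s /\ E (history x (size s + n.+1))] =
          \bigcup_i A i.
  apply/seteqP; split => [x [xs]|x [i _ [[xi xs]]]].
    rewrite -addSnnS => xE; exists (x (size s)) => //; split=> //.
    by rewrite [LHS]/= xs.
  by rewrite [size _]/= addSnnS.
have mA i : measurable (A i : set (codeSpace N)) by have [] := IH (i :: s).
split; first by apply: fin_bigcup_measurable => //; exact: finite_finset.
rewrite measure_fin_bigcup//; last 2 first.
- exact: finite_finset.
- by move=> i j _ _ [x [[[<- _] _] [[<- _] _]]].
transitivity (\sum_(i <- index_enum I) P (A i))%E.
  have -> : [set: I] = [set` index_enum I].
    by apply/seteqP; split => i //= _; rewrite mem_index_enum.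
  by rewrite -fsbig_seq ?index_enum_uniq.
transitivity ((\sum_i weight p s * (p i * wsum p n (fun u => (E (u ++ i :: s))%:R)))%:E).
  rewrite -sumEFin; apply: eq_bigr => i _.
  by have [_ ->] := IH (i :: s); rewrite weight_cons mulrCA mulrA.
rewrite -mulr_sumr -[wsum p n _]/(wsum p n.+1 (fun u => (E (u ++ s))%:R)) wsum_rcons.
congr ((_ * _)%:E); apply: eq_bigr => i _; congr (_ * _).
by apply: eq_wsum => u _; rewrite cat_rcons.
Qed.

Lemma measurable_history E n :
  measurable ([set x | E (history x n)] : set (codeSpace N)).
Proof.
have [+ _] := history_event E n [::]; rewrite (_ : [set x | _] = [set x | E (history x n)])//.
by apply/seteqP; split => x //= [].
Qed.

Lemma probability_history E n :
  P [set x | E (history x n)] = (wsum p n (fun s => (E s)%:R))%:E.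
Proof.
have [_] := history_event E n [::]; rewrite (_ : [set x | _] = [set x | E (history x n)]); last first.
  by apply/seteqP; split => x //= [].
move=> ->; rewrite weight_nil mul1r; congr (_%:E).
by apply: eq_wsum => s _; rewrite cats0.
Qed.

End Bernoulli.

Section WaitingTime.
Context {R : realType} {d N : nat}.
Notation I := 'I_N.+1.
Variables (S : I -> 'rV[R]_d -> 'rV[R]_d) (F : set 'rV[R]_d).
Variables (delta : R) (v : 'rV[R]_d).
Hypothesis hF : is_attractor S F.
Hypothesis Fv : F v.
Implicit Types (x : nat -> I) (s u : seq I).

Definition covered s : Prop := forall z, F z ->
  exists2 j, (j < size s)%N & eucl_dist (foldr S v (drop j s)) z <= delta.

Lemma chaos_orbitE x n : chaos_orbit S v x n = foldr S v (history x n).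
Proof. by elim: n => //= n ->. Qed.

Lemma covered_cat u s : covered s -> covered (u ++ s).
Proof.
move=> h z /h[j js hj]; exists (size u + j)%N; first by rewrite size_cat ltn_add2l.
by rewrite drop_cat ltnNge leq_addr /= addKn.
Qed.

Lemma covered_history_mono x m n : (m <= n)%N ->
  covered (history x m) -> covered (history x n).
Proof.
move=> mn h; rewrite -(cat_take_drop (n - m) (history x n)).
by rewrite -[X in history x X](subnK mn) drop_history; exact: covered_cat.
Qed.

Lemma delta_dense_covered x n : delta_dense F delta
    [set chaos_orbit S v x k | k in [set k : nat | (1 <= k <= n)%N]] <->
  covered (history x n).
Proof.
have e j : (j < n)%N -> drop j (history x n) = history x (n - j).
  by move=> jn; rewrite -[X in history x X](subnKC (ltnW jn)) drop_history.
have Forb k : F (chaos_orbit S v x k).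
  elim: k => //= k IH; have [_ _ ->] := hF.
  by exists (x k) => //; exists (chaos_orbit S v x k).
split.
  move=> [_ h] z /h[_ [k /= /andP[k1 kn] <-] hk].
  exists (n - k)%N; first by rewrite size_history ltn_subrL k1 (leq_trans k1).
  rewrite e ?ltn_subrL ?k1 ?(leq_trans k1)// subKn//.
  by rewrite -chaos_orbitE.
move=> h; split; first by move=> _ [k _ <-].
move=> z /h[j]; rewrite size_history => jn; rewrite e// -chaos_orbitE => hj.
by exists (chaos_orbit S v x (n - j)) => //; exists (n - j)%N; rewrite //= subn_gt0 jn leq_subr.
Qed.

Definition uncovered s : bool := ~~ `[< covered s >].

Lemma uncoveredP s : reflect (~ covered s) (uncovered s).
Proof. exact: asboolPn. Qed.

(** Once the orbit is dense it stays so; hence the waiting time counts the times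
    at which it is not yet dense. Time [0], with no orbit point, is one of
    them. *)
Lemma waiting_time_series x : waiting_time S F delta v x =
  (\sum_(0 <= n <oo) (uncovered (history x n))%:R%:E)%E.
Proof.
have nn n : (0 <= (uncovered (history x n))%:R%:E :> \bar R)%E by rewrite lee_fin.
have [[n cn]|nocov] := pselect (exists n, covered (history x n)).
  have exn : exists n, `[< covered (history x n) >] by exists n; apply/asboolP.
  have [m /asboolP cm mmin] := ex_minnP exn.
  have m1 : (1 <= m)%N.
    rewrite lt0n; apply/eqP => m0; move: cm; rewrite m0 => /(_ v Fv)[j].
    by rewrite ltn0.
  have partial k : (\sum_(0 <= n < k) (uncovered (history x n))%:R%:E = (minn k m)%:R%:E :> \bar R)%E.
    elim: k => [|k IH]; first by rewrite big_nil min0n.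
    rewrite big_nat_recr//= IH -EFinD -natrD; congr (_%:R%:E).
    have [mk|km] := leqP m k.
      rewrite (minn_idPr (leqW mk)) (_ : uncovered _ = false) ?addn0//.
      by apply/uncoveredP => h; apply: h; exact: covered_history_mono cm.
    rewrite (minn_idPl km) (_ : uncovered _ = true) ?addn1//.
    by apply/uncoveredP => /asboolP /mmin; rewrite leqNgt km.
  transitivity (m%:R%:E : \bar R)%E; apply/eqP; rewrite eq_le; apply/andP; split.
  - rewrite /waiting_time; set W := (X in ereal_inf X).
    suff : W m%:R%:E by move=> /ereal_inf_lbound.
    by exists m => //; split => //; exact/delta_dense_covered.
  - apply: le_ereal_inf_tmp; move=> _ [k [k1 hk] <-].
    have /mmin mk : `[< covered (history x k) >] by apply/asboolP/delta_dense_covered.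
    by rewrite lee_fin ler_nat.
  - have := partial m; rewrite minnn => <-.
    exact: nneseries_lim_ge.
  - apply: lime_le; first exact: is_cvg_nneseries.
    by apply: nearW => k; rewrite partial lee_fin ler_nat geq_minr.
rewrite /waiting_time (_ : [set _ | _ in _] = set0); last first.
  apply/seteqP; split => // y [k [_ hk] _].
  by apply: nocov; exists k; exact/delta_dense_covered.
rewrite ereal_inf0; apply/esym/eqyP => A A0.
have unc n : uncovered (history x n) by apply/uncoveredP => h; apply: nocov; exists n.
apply: (@le_trans _ _ (\sum_(0 <= n < (Num.truncn A).+1)
    (uncovered (history x n))%:R%:E)%E); last exact: nneseries_lim_ge.
rewrite (eq_bigr (fun=> 1%:E)) => [|n _]; last by rewrite unc.
rewrite sumEFin lee_fin big_const_nat subn0 iter_addr_0.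
by rewrite ltW// truncnS_gt.
Qed.

Variables (p : I -> R) (P : probability (codeSpace N) R).
Hypothesis hP : bernoulli_measure p P.
Hypothesis hp : nondegenerate_probability_vector p.

Definition uncovered_prob n : R := wsum p n (fun s => (uncovered s)%:R).

Let p0 i : 0 <= p i. Proof. by have [/(_ i)/ltW] := hp. Qed.

Lemma uncovered_prob_ge0 n : 0 <= uncovered_prob n.
Proof. exact: wsum_ge0. Qed.

Lemma expected_waiting_time_series : expected_waiting_time S F P delta v =
  (\sum_(0 <= n <oo) (uncovered_prob n)%:E)%E.
Proof.
rewrite /expected_waiting_time.
have mA n := measurable_history hP uncovered n.
pose A n := [set x | uncovered (history x n)] : set (codeSpace N).
transitivity (\int[P]_x (\sum_(0 <= n <oo) (\1_(A n) x)%:E))%E.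
  apply: eq_integral => x _; rewrite waiting_time_series.
  apply: eq_eseriesr => n _; congr (_%:E); rewrite indicE.
  by have -> : (x \in A n) = uncovered (history x n) by apply/idP/idP; rewrite inE.
rewrite integral_nneseries//; last first.
  by move=> n; apply/measurable_EFinP/measurable_indic; exact: mA.
apply: eq_eseriesr => n _.
rewrite integral_indic; [|exact: measurableT|exact: mA].
by rewrite setIT; exact: (probability_history hP uncovered n).
Qed.

Lemma expected_waiting_time_le (C : R) :
  (forall n0, \sum_(n < n0) uncovered_prob n <= C) ->
  (expected_waiting_time S F P delta v <= C%:E)%E.
Proof.
move=> h; rewrite expected_waiting_time_series; apply: lime_le.
  by apply: is_cvg_nneseries => n _ _; rewrite lee_fin uncovered_prob_ge0.
by apply: nearW => k; rewrite sumEFin lee_fin big_mkord.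
Qed.

(** The tail probabilities do not increase with time. *)
Lemma expected_waiting_time_ge m :
  ((m.+1%:R * uncovered_prob m)%:E <= expected_waiting_time S F P delta v)%E.
Proof.
rewrite expected_waiting_time_series.
apply: (@le_trans _ _ (\sum_(0 <= n < m.+1) (uncovered_prob n)%:E)%E); last first.
  by apply: nneseries_lim_ge => n _ _; rewrite lee_fin uncovered_prob_ge0.
rewrite sumEFin lee_fin big_mkord mulr_natl -[X in _ *+ X]card_ord -sumr_const.
apply: ler_sum => -[n /= nm] _; rewrite ltnS in nm.
have p1 : \sum_i p i = 1 by have [] := hp.
rewrite /uncovered_prob -[leRHS](expectation_drop p1 _ (m - n)) subnK//.
apply: le_wsum => // s _; rewrite ler_nat -{1}(cat_take_drop (m - n) s).
case: (uncoveredP (drop _ _)) => [_|/contrapT h]; first by case: uncovered.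
by rewrite (_ : uncovered _ = false)//; apply/uncoveredP; apply; exact: covered_cat.
Qed.

Lemma expected_waiting_time_ge1 :
  (1%:E <= expected_waiting_time S F P delta v)%E.
Proof.
apply: le_trans (expected_waiting_time_ge 0).
rewrite mul1r /uncovered_prob /= (_ : uncovered _ = true)//.
by apply/uncoveredP => /(_ v Fv) [].
Qed.

End WaitingTime.

(** * The lower bound *)

(** Concatenations of [n] blocks have a common length, probability and ratio, and
    their number is exponential in [n]. *)
Lemma block_power (R : realType) (I : finType) (p r : I -> R)
    (B : seq (seq I)) (a : nat) (q rho : R) (n : nat) :
  uniq B ->
  {in B, forall b, [/\ size b = a, weight p b = q & weight r b = rho]} ->
  exists A : seq (seq I), [/\ uniq A, size A = (size B ^ n)%N &
    {in A, forall w, [/\ size w = (a * n)%N, weight p w = q ^+ n &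
                         weight r w = rho ^+ n]}].
Proof.
move=> uB hB; elim: n => [|n [A [uA sA hA]]].
  exists [:: [::]]; split => // w; rewrite inE => /eqP ->.
  by rewrite !weight_nil muln0 !expr0.
exists [seq b ++ w | b <- B, w <- A]; split.
- apply: allpairs_uniq => // -[b w] [b' w'] /allpairsP[[c z] /= [cB zA [-> ->]]].
  move=> /allpairsP[[c' z'] /= [c'B z'A [-> ->]]] /eqP.
  have [sc _ _] := hB _ cB; have [sc' _ _] := hB _ c'B.
  by rewrite eqseq_cat ?sc ?sc'// => /andP[/eqP -> /eqP ->].
- by rewrite size_allpairs sA expnS.
move=> _ /allpairsP[[b w] /= [/hB[sb pb rb] /hA[sw pw rw] ->]].
by rewrite size_cat !weight_cat sb sw pb pw rb rw mulnS !exprS.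
Qed.

Section LowerBound.
Context {R : realType} {d N : nat}.
Notation I := 'I_N.+1.
Variables (S : I -> 'rV[R]_d -> 'rV[R]_d) (r p : I -> R) (F : set 'rV[R]_d).
Variable P : probability (codeSpace N) R.
Hypothesis hS : forall i, similitude (S i) (r i).
Hypothesis hF : is_attractor S F.
Hypothesis hp : nondegenerate_probability_vector p.
Hypothesis hP : bernoulli_measure p P.
Variables (x0 : 'rV[R]_d) (u : seq I).
Hypothesis Fx0 : F x0.
Hypothesis u_good : forall w v,
  stopping r (weight r (w ++ u)) v ->
  (exists2 y, F y & eucl_dist (foldr S x0 (w ++ u)) (foldr S y v)
     <= weight r (w ++ u)) ->
  prefix w v.
Variables (A : seq (seq I)) (l : nat) (q rho : R).
Hypothesis uA : uniq A.
Hypothesis l0 : (0 < l)%N.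
Hypothesis hA : {in A, forall w,
  [/\ size w = l, weight p w = q & weight r w = rho]}.
Hypothesis rho0 : 0 < rho.
Hypothesis q0 : 0 < q.

Let r0 i : 0 < r i. Proof. by have [/andP[]] := hS i. Qed.

(** A word [w] of [A] that does not occur in the history can be visited only at
    one of the first [l] times, while the code of the orbit point still depends
    on the starting point; each of these times serves a single word of [A],
    because [u_good] reads [w] off that code. *)
Lemma covered_unseen delta v s : F v -> delta <= rho * weight r u ->
  covered S F delta v s -> (unseen A s <= l)%N.
Proof.
move=> Fv dl cs; set rho' := rho * weight r u in dl.
have rho'0 : 0 < rho' by rewrite mulr_gt0 ?weight_gt0.
have [f hf] := choice (fun s' => stopping_cover_history hS hF s' rho'0 Fv).
(* [code k] is the word of length [l] visited at time [k]. *)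
pose code k := take l (f (drop (size s - k) s)).
rewrite /unseen -size_filter -(size_iota 0 l) -(size_map code).
apply: uniq_leq_size; first exact: filter_uniq.
move=> w; rewrite mem_filter => /andP[ws wA].
have [sw _ rw] := hA wA.
have rwu : weight r (w ++ u) = rho' by rewrite weight_cat rw.
have Fz : F (foldr S x0 (w ++ u)) by exact: word_attractor.
have [j js hj] := cs _ Fz.
have [cw' [y Fy yE] pre] := hf (drop j s).
have pw : prefix w (f (drop j s)).
  apply: u_good; rewrite rwu//; exists y => //.
  by rewrite -yE eucl_distC (le_trans hj).
have nowj : ~~ prefix w (drop j s).
  apply: contra ws => wj; rewrite -(cat_take_drop j s).
  by apply: infix_catl; exact: prefixW.
have pj : prefix (drop j s) (f (drop j s)).
  case/orP: pre => // fj.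
  by move: nowj; rewrite (prefix_trans pw fj).
have lj : (size s - j < l)%N.
  rewrite -size_drop ltnNge; apply: contra nowj => lj.
  move: pw; rewrite !prefixE sw => /eqP <-; apply/eqP.
  move: pj; rewrite prefixE => /eqP {1}<-.
  by rewrite take_takel.
apply/mapP; exists (size s - j)%N; first by rewrite mem_iota.
rewrite /code subKn 1?ltnW//.
by move: pw; rewrite prefixE sw => /eqP.
Qed.

(** Up to time [H / (4 * q)], where [H] is the logarithm, [F] is still uncovered
    with probability at least one half. *)
Lemma expected_waiting_time_lower delta v : F v -> delta <= rho * weight r u ->
  ((ln ((size A)%:R / (2 * l)%:R) / (8 * q))%:E <=
     expected_waiting_time S F P delta v)%E.
Proof.
move=> Fv dl; set H := ln _.
have [p0' p1] := hp; have p0 i : 0 <= p i by exact: ltW.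
have [H0|H0] := leP H 0.
  apply: le_trans (expected_waiting_time_ge1 _ _ Fv hP hp) => //.
  rewrite lee_fin (le_trans (y := 0))// pmulr_lle0// invr_gt0 mulr_gt0//.
have lA : (2 * l <= size A)%N.
  rewrite leqNgt; apply/negP => h; move: H0; rewrite ltNge => /negP; apply.
  apply: ln_le0; rewrite ler_pdivrMr ?mul1r ?ler_nat ?ltr0n ?muln_gt0 ?l0//.
  exact: ltnW.
pose m := Num.truncn (H / (4 * q)).
have x0' : 0 <= H / (4 * q) by rewrite divr_ge0 ?mulr_ge0 ?ltW.
have hm : (m%:R : R) <= H / (4 * q) by rewrite truncn_le.
have hm1 : H / (4 * q) < (m.+1%:R : R) by exact: truncnS_gt.
apply: le_trans (expected_waiting_time_ge _ _ _ hP hp m) => //.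
rewrite lee_fin.
have Asize : {in A, forall w, size w = l} by move=> w /hA[].
have Aw : {in A, forall w, weight p w <= q} by move=> w /hA[_ ->].
have := few_unseen p0 p1 uA Asize Aw l0 (ltW q0) m lA; rewrite -/H.
set pr := wsum p m _ => prH.
have pr2 : pr <= 2^-1.
  rewrite -(ler_pM2r H0); apply: (le_trans prH).
  by move: hm; rewrite ler_pdivlMr ?mulr_gt0//; lra.
have up : 2^-1 <= uncovered_prob S F delta v p m.
  apply: (@le_trans _ _ (1 - pr)); first lra.
  rewrite -(expectation_cst p1 m 1) -wsumB; apply: le_wsum => // s _.
  case: (uncoveredP S F delta v s) => [_|/contrapT /(covered_unseen Fv dl) ->] /=.
    by rewrite lerBlDr lerDl.
  by rewrite subrr.
apply: (@le_trans _ _ (m.+1%:R * 2^-1)); last by rewrite ler_pM2l.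
rewrite (_ : H / (8 * q) = (H / (4 * q)) * 2^-1).
  by rewrite ler_pM2r// ltW.
by field; rewrite gt_eqF.
Qed.

End LowerBound.

(** The best power [th ^+ k] for a given [delta], with [k] comparable to
    [ln delta^-1]. *)
Lemma scale_choice (R : realType) (th c : R) : 0 < th < 1 -> 0 < c ->
  exists kappa L0 : R, 0 < kappa /\ forall delta, 0 < delta ->
    L0 <= ln delta^-1 ->
    exists k : nat, [/\ delta <= c * th ^+ k, c * th ^+ k.+1 <= delta &
      kappa * ln delta^-1 <= k%:R].
Proof.
move=> /andP[th0 th1] c0; pose b := - ln th.
have b0 : 0 < b by rewrite oppr_gt0 ln_lt0// th0.
exists (2 * b)^-1, (2 * (b + `|ln c|)); split; first by rewrite invr_gt0 mulr_gt0.
move=> delta d0; rewrite lnV ?posrE// => hL.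
have nc : - `|ln c| <= ln c by rewrite lerNl -normrN ler_norm.
have c0' := normr_ge0 (ln c).
pose X := (- ln delta + ln c) / b.
have X0 : 0 <= X by rewrite divr_ge0 ?ltW//; lra.
have h1 : (Num.truncn X)%:R <= X by rewrite truncn_le.
have h2 : X < (Num.truncn X).+1%:R by exact: truncnS_gt.
have lnk k : ln (c * th ^+ k) = ln c - k%:R * b.
  by rewrite lnM ?posrE ?exprn_gt0// lnXn// /b mulrN opprK mulr_natl.
exists (Num.truncn X); split.
- rewrite -ler_ln ?posrE ?mulr_gt0 ?exprn_gt0// lnk.
  move: h1; rewrite ler_pdivlMr//; lra.
- rewrite -ler_ln ?posrE ?mulr_gt0 ?exprn_gt0// lnk.
  move: h2; rewrite ltr_pdivrMr//; lra.
rewrite mulrC ler_pdivrMr ?mulr_gt0//.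
move: h2; rewrite ltr_pdivrMr// -natr1; lra.
Qed.

Section LowerAsymptotics.
Context {R : realType} {d N : nat}.
Notation I := 'I_N.+1.
Variables (S : I -> 'rV[R]_d -> 'rV[R]_d) (r p : I -> R) (F : set 'rV[R]_d).
Variable P : probability (codeSpace N) R.
Hypothesis hS : forall i, similitude (S i) (r i).
Hypothesis hOSC : open_set_condition S.
Hypothesis hF : is_attractor S F.
Hypothesis hp : nondegenerate_probability_vector p.
Hypothesis hP : bernoulli_measure p P.

(** From families of words at the discrete scales [c1 * th ^+ k] to all [delta].
    The discrete scales control small [delta]; the remaining ones are absorbed in
    the constant because the waiting time is at least [1]. In the hypotheses
    [h k] is the logarithmic gain of the [k]-th family, and [g] is the growth
    that it yields as a function of [ln delta^-1]. *)
Lemma lower_asymptotics (g : R -> R) (h : nat -> R) (th c1 c2 t : R) :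
  0 < th < 1 -> 0 < c1 -> 0 < c2 -> 0 <= t ->
  (forall k, exists A l q rho, [/\ uniq A, (0 < l)%N,
     {in A, forall w, [/\ size w = l, weight p w = q & weight r w = rho]},
     rho = c1 * th ^+ k &
     0 < q <= c2 * (th ^+ k) `^ t /\ h k <= ln ((size A)%:R / (2 * l)%:R)]) ->
  (forall kappa, 0 < kappa -> exists L1 c3, 0 < c3 /\ forall L k,
     L1 <= L -> kappa * L <= k%:R -> c3 * g L <= h k) ->
  (forall L L', 0 < L -> L <= L' -> g L <= g L') ->
  exists2 C : R, 0 < C & forall v, F v -> forall delta, 0 < delta < 1 ->
    ((C^-1 * delta `^ (- t) * g (ln delta^-1))%:E <=
       expected_waiting_time S F P delta v)%E.
Proof.
move=> th01 c10 c20 t0 fam hg gmono.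
have /andP[th0 th1] := th01.
have [[x0 Fx0] _ _] := hF.
have [u u_good] := good_word hS hF hOSC Fx0.
have r0 i : 0 < r i by have [/andP[]] := hS i.
pose c := c1 * weight r u.
have c0 : 0 < c by rewrite mulr_gt0// weight_gt0.
have [kappa [L0 [kappa0 hk]]] := scale_choice th01 c0.
have [L1 [c3 [c30 hc3]]] := hg _ kappa0.
pose L2 := Num.max L0 L1.
pose C1 := 8 * c2 / (c3 * (c * th) `^ t).
pose C2 := expR (t * L2) * (`|g L2| + 1).
have C10 : 0 < C1 by rewrite divr_gt0// mulr_gt0// powR_gt0// mulr_gt0.
have C20 : 0 < C2 by rewrite mulr_gt0 ?expR_gt0// ltr_wpDl.
exists (C1 + C2) => [|v Fv delta /andP[d0 d1]]; first exact: addr_gt0.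
set L := ln delta^-1.
have L0' : 0 < L by rewrite ln_gt0// invf_gt1.
have ew1 := expected_waiting_time_ge1 delta hF Fv hP hp.
have [gL|gL] := leP (g L) 0.
  apply: le_trans ew1; rewrite lee_fin (le_trans (y := 0))//.
  by rewrite mulr_ge0_le0// mulr_ge0 ?powR_ge0// invr_ge0 addr_ge0 ?ltW.
have dp : 0 < delta `^ (- t) by rewrite powR_gt0.
have [hL|hL] := leP L2 L; last first.
  apply: le_trans ew1; rewrite lee_fin -mulrA mulrC ler_pdivrMr ?addr_gt0// mul1r.
  apply: (@le_trans _ _ C2); last by rewrite lerDr ltW.
  apply: (ler_pM (ltW dp) (ltW gL)).
    rewrite /powR gt_eqF// ler_expR mulNr -mulrN -lnV ?posrE//.
    by rewrite ler_wpM2l// ltW.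
  apply: (le_trans (gmono _ _ L0' (ltW hL))).
  by apply: (le_trans (ler_norm _)); rewrite lerDl.
move: hL; rewrite ge_max => /andP[hL0 hL1].
have [k [dk kd kL]] := hk _ d0 hL0.
have [A [l [q [rho [uA l0 hA rhoE [/andP[q0 qle] hle]]]]]] := fam k.
have rho0 : 0 < rho by rewrite rhoE mulr_gt0// exprn_gt0.
have dle : delta <= rho * weight r u by rewrite rhoE mulrAC.
apply: le_trans (expected_waiting_time_lower hS hF hp hP Fx0 u_good uA l0 hA rho0 q0 Fv dle) => //.
rewrite lee_fin.
have hH : c3 * g L <= ln ((size A)%:R / (2 * l)%:R).
  exact: le_trans (hc3 _ _ hL1 kL) hle.
apply: (@le_trans _ _ (c3 * g L / (8 * q))); last first.
  by rewrite ler_pM2r// invr_gt0 mulr_gt0.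
apply: (@le_trans _ _ (C1^-1 * delta `^ (- t) * g L)).
  rewrite ler_pM2r// ler_pM2r// lef_pV2 ?posrE ?addr_gt0//.
  by rewrite lerDl ltW.
rewrite ler_pdivlMr ?mulr_gt0//.
have ct0 : 0 < (c * th) `^ t by rewrite powR_gt0// mulr_gt0.
have qd : q <= c2 * (delta `^ t / (c * th) `^ t).
  apply: (le_trans qle); rewrite ler_pM2l// ler_pdivlMr//.
  have thk m : 0 <= th ^+ m by rewrite exprn_ge0// ltW.
  have cth : 0 <= c * th by rewrite ltW// mulr_gt0.
  rewrite -(powRM t (thk k) cth).
  rewrite (_ : th ^+ k * (c * th) = c * th ^+ k.+1); last by rewrite exprSr; ring.
  apply: ge0_ler_powR; rewrite ?nnegrE ?(ltW d0)//.
  exact: mulr_ge0 (ltW c0) (thk _).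
have -> : C1^-1 = c3 * (c * th) `^ t / (8 * c2) by rewrite invf_div.
rewrite powRN.
have dt0 : 0 < delta `^ t by rewrite powR_gt0.
apply: (@le_trans _ _ (c3 * (c * th) `^ t / (8 * c2) * (delta `^ t)^-1 * g L *
   (8 * (c2 * (delta `^ t / (c * th) `^ t))))).
  rewrite ler_pM2l ?ler_pM2l// !mulr_gt0// invr_gt0// ?mulr_gt0//.
rewrite le_eqVlt; apply/orP; left; apply/eqP.
by field; rewrite !gt_eqF.
Qed.

End LowerAsymptotics.

(** * The upper bound *)

Section WeightFacts.
Context {R : realType} {I : finType}.
Implicit Types (x y : I -> R) (w : seq I).

Lemma weight_powR x t w : (forall i, 0 <= x i) ->
  weight (fun i => x i `^ t) w = weight x w `^ t.
Proof.
move=> x0; elim: w => [|i w IH]; first by rewrite !weight_nil powR1.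
by rewrite !weight_cons IH powRM// /weight prodr_ge0.
Qed.

Lemma weightM x y w : weight (fun i => x i * y i) w = weight x w * weight y w.
Proof. by rewrite /weight big_split. Qed.

Lemma eq_weight x y w : x =1 y -> weight x w = weight y w.
Proof. by move=> xy; apply: eq_bigr => i _. Qed.

(** Bernoulli's inequality. It replaces a product by a sum in the exponent, so
    that the union bound factorizes over the letters. *)
Lemma weight_ge1 x w : (forall i, 1 <= x i) ->
  1 + \sum_(i <- w) (x i - 1) <= weight x w.
Proof.
move=> x1; elim: w => [|i w IH]; first by rewrite big_nil weight_nil addr0.
rewrite big_cons weight_cons.
have h0 : 0 <= \sum_(i <- w) (x i - 1) by apply: sumr_ge0 => j _; rewrite subr_ge0.
have := x1 i; move: IH h0; set s := \sum_(_ <- _) _; set W := weight _ _ => ? ? ?; nra.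
Qed.

Lemma weight_expR (y : R) x w :
  weight (fun i => expR (- (y * (x i - 1)))) w =
  expR (- (y * \sum_(i <- w) (x i - 1))).
Proof.
elim: w => [|i w IH]; first by rewrite big_nil weight_nil mulr0 oppr0 expR0.
by rewrite weight_cons big_cons IH -expRD; congr expR; ring.
Qed.
End WeightFacts.

Section UpperBound.
Context {R : realType} {d N : nat}.
Notation I := 'I_N.+1.
Variables (S : I -> 'rV[R]_d -> 'rV[R]_d) (r p : I -> R) (F : set 'rV[R]_d).
Variable P : probability (codeSpace N) R.
Hypothesis hS : forall i, similitude (S i) (r i).
Hypothesis hF : is_attractor S F.
Hypothesis hp : nondegenerate_probability_vector p.
Hypothesis hP : bernoulli_measure p P.
Variables (D : R).
Hypothesis D1 : 1 <= D.
Hypothesis hD : forall x y, F x -> F y -> eucl_dist x y <= D.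

Let r0 i : 0 < r i. Proof. by have [/andP[]] := hS i. Qed.
Let p0' i : 0 < p i. Proof. by have [] := hp. Qed.
Let p0 i : 0 <= p i. Proof. exact: ltW. Qed.
Let p1 : \sum_i p i = 1. Proof. by have [] := hp. Qed.

Let one := (fun _ : I => 1 : R).
Let one0 i : 0 <= one i. Proof. by []. Qed.

(** A point of [F] is coded by a word of length at most [L] stopped at the scale
    [delta / D]. If that word occurs in the history, the orbit has entered the
    piece, which has diameter at most [delta]. *)
Lemma uncovered_union L (delta : R) v s : F v -> 0 < delta < 1 ->
  rmax r ^+ L <= delta / D ->
  (uncovered S F delta v s)%:R <= \sum_(l < L.+1) wsum one l
    (fun w => (stopping r (delta / D) w)%:R * (~~ infix w s)%:R).
Proof.
move=> Fv /andP[d0 d1] hL.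
have D0 : 0 < D by exact: lt_le_trans D1.
have rho1 : delta / D < 1 by rewrite ltr_pdivrMr// mul1r (lt_le_trans d1).
have nn w : 0 <= (stopping r (delta / D) w)%:R * (~~ infix w s)%:R :> R by rewrite mulr_ge0.
case: (uncoveredP S F delta v s) => [unc|_]; last first.
  by apply: sumr_ge0 => l _; apply: wsum_ge0.
have [w [wL cw ws]] : exists w, [/\ (size w <= L)%N, stopping r (delta / D) w & ~~ infix w s].
  apply: contra_notP unc => nw z Fz.
  have [w [wL cw [y Fy ->]]] := stopping_cover hS hF Fz hL.
  have /infixP[s1 [s2 sE]] : infix w s.
    by apply: contra_notT nw => ws; exists w.
  exists (size s1).
    rewrite sE !size_cat -[X in (X < _)%N]addn0 ltn_add2l addn_gt0.
    by case: (w) cw => //=; rewrite leNgt rho1.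
  rewrite sE drop_size_cat// foldr_cat (dist_word hS).
  apply: (@le_trans _ _ (delta / D * D)); last by rewrite divfK// gt_eqF.
  apply: ler_pM; rewrite ?eucl_dist_ge0 ?(stopping_le hS)//.
    by rewrite ltW// weight_gt0.
  by apply: hD => //; exact: word_attractor.
rewrite (bigD1 (Ordinal (n := L.+1) (m := size w) wL))//=.
apply: (@le_trans _ _ (wsum one (size w) (fun w => (stopping r (delta / D) w)%:R * (~~ infix w s)%:R))); last first.
  by rewrite lerDl; apply: sumr_ge0 => l _; apply: wsum_ge0.
have := wsum_ge_term one0 w nn.
by rewrite cw ws !mulr1 /weight big1.
Qed.

Lemma uncovered_prob_union L (delta : R) v n : F v -> 0 < delta < 1 ->
  rmax r ^+ L <= delta / D ->
  uncovered_prob S F delta v p n <= \sum_(l < L.+1) wsum one l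
    (fun w => (stopping r (delta / D) w)%:R * missing p w n).
Proof.
move=> Fv d01 hL.
apply: (@le_trans _ _ (wsum p n (fun s => \sum_(l < L.+1) wsum one l
    (fun w => (stopping r (delta / D) w)%:R * (~~ infix w s)%:R)))).
  by apply: le_wsum => // s _; exact: uncovered_union.
rewrite wsum_sum le_eqVlt; apply/orP; left; apply/eqP.
apply: eq_bigr => l _; rewrite wsum_exchange; apply: eq_wsum => w _.
by rewrite wsumZ.
Qed.

Lemma uncovered_prob_le1 delta v n : uncovered_prob S F delta v p n <= 1.
Proof.
rewrite -[leRHS](expectation_cst p1 n); apply: le_wsum => // s _.
by case: uncovered.
Qed.

(** The first [M] tail probabilities are bounded by [1], the later ones by the
    union bound and the mean waiting time of each word after time [M]. *)
Lemma expected_waiting_time_upper (th : R) L M (delta : R) v :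
  (forall i, p i <= th) -> th < 1 ->
  F v -> 0 < delta < 1 -> rmax r ^+ L <= delta / D ->
  (expected_waiting_time S F P delta v <= (M%:R + \sum_(l < L.+1) wsum one l
    (fun w => (stopping r (delta / D) w)%:R *
              (missing p w M * (1 - th)^-1 / weight p w)))%:E)%E.
Proof.
move=> pth th1 Fv d01 hL; apply: expected_waiting_time_le => // n0.
apply: (@le_trans _ _ (\sum_(n < M + n0) uncovered_prob S F delta v p n)).
  rewrite addnC big_split_ord /= lerDl; apply: sumr_ge0 => n _.
  exact: uncovered_prob_ge0.
rewrite big_split_ord /=; apply: lerD.
  rewrite -[X in _ <= X%:R]card_ord -sumr_const; apply: ler_sum => n _.
  exact: uncovered_prob_le1.
apply: (@le_trans _ _ (\sum_(n < n0) \sum_(l < L.+1) wsum one l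
    (fun w => (stopping r (delta / D) w)%:R * missing p w (M + n)))).
  by apply: ler_sum => n _; exact: uncovered_prob_union.
rewrite exchange_big /=; apply: ler_sum => l _.
rewrite -wsum_sum; apply: le_wsum => // w _.
rewrite -mulr_sumr; apply: ler_wpM2l => //.
rewrite ler_pdivlMr ?weight_gt0// mulrC.
exact: sum_missing_tail.
Qed.

Variable t : R.
Hypothesis t0 : 0 <= t.
Let lam i := p i * r i `^ (- t).
Hypothesis lam1 : forall i, 1 <= lam i.

(** On stopping words the ratio is of order [delta], and [lam] measures how far
    [p] exceeds the power [t] of the ratios. *)
Lemma stopping_weight delta w : 0 < delta -> delta / D <= 1 ->
  stopping r (delta / D) w ->
  (rmin r / D) `^ t * delta `^ t * weight lam w <= weight p w.
Proof.
move=> d0 d1 cw; have D0 : 0 < D by exact: lt_le_trans D1.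
have m0 := rmin_gt0 hS.
have -> : weight p w = weight r w `^ t * weight lam w.
  rewrite -weight_powR => [|i]; last exact: ltW.
  rewrite -weightM; apply: eq_weight => i.
  by rewrite /lam mulrCA -powRD ?subrr ?powRr0 ?mulr1// (gt_eqF (r0 i)) implybT.
rewrite ler_pM2r; last by apply: weight_gt0 => i; exact: lt_le_trans (lam1 i).
rewrite -powRM ?divr_ge0 ?(ltW d0) ?(ltW m0) ?(ltW D0)//.
apply: ge0_ler_powR; rewrite ?nnegrE ?mulr_ge0 ?invr_ge0 ?(ltW d0) ?(ltW m0) ?(ltW D0)//.
  by rewrite ltW// weight_gt0.
by rewrite mulrAC -mulrA; exact: stopping_ge.
Qed.

(** The parameter [y] measures the initial period, of length of order
    [y * delta `^ (- t)], after which the union bound has to be small. The word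
    [w] contributes at most [expR (- y * weight lam w)], up to constants, and
    the sum over the words of one length is a power of a sum over letters. *)
Lemma upper_parameter (th : R) : (forall i, p i <= th) -> th < 1 ->
  (exists i, lam i = 1) ->
  exists K1 K2 : R, [/\ 0 < K1, 0 < K2 &
  forall v delta y L, F v -> 0 < delta < 1 -> 0 <= y ->
    rmax r ^+ L <= delta / D ->
    (expected_waiting_time S F P delta v <=
      (delta `^ (- t) * (1 + K1 * y + K2 * L.+1%:R * expR (- y) *
         (\sum_i expR (- (y * (lam i - 1)))) ^+ L))%:E)%E].
Proof.
move=> pth th1 [i0 lam_i0].
have D0 : 0 < D by exact: lt_le_trans D1.
have m0 := rmin_gt0 hS.
pose c1 := (rmin r / D) `^ t.
have c10 : 0 < c1 by rewrite powR_gt0// divr_gt0.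
have th1' : 0 < 1 - th by rewrite subr_gt0.
have [c cE] : exists c, c = ln 2 * (1 - th) / 3 by exists (ln 2 * (1 - th) / 3).
have c0 : 0 < c by rewrite cE !mulr_gt0// ln_gt0// ltr1n.
exists (c * c1)^-1, (2 * (1 - th)^-1 / c1); split.
- by rewrite invr_gt0 mulr_gt0.
- by rewrite divr_gt0// mulr_gt0// invr_gt0.
move=> v delta y L Fv d01 y0 hL; have /andP[d0 d1] := d01.
have dt0 : 0 < delta `^ t by rewrite powR_gt0.
have rho1 : delta / D <= 1 by rewrite ler_pdivrMr// mul1r ltW// (lt_le_trans d1).
pose X := y / (c * c1 * delta `^ t).
have X0 : 0 <= X by rewrite divr_ge0// !mulr_ge0// ltW.
pose M := (Num.truncn X).+1.
have hM : X < M%:R by exact: truncnS_gt.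
have hM1 : M%:R <= X + 1 :> R by rewrite /M -natr1 lerD2r truncn_le.
apply: (le_trans (expected_waiting_time_upper M pth th1 Fv d01 hL)).
rewrite lee_fin powRN.
pose g i := expR (- (y * (lam i - 1))).
pose G := \sum_i g i.
have g0 i : 0 <= g i by exact: expR_ge0.
have G1 : 1 <= G.
  rewrite /G (bigD1 i0)//= /g lam_i0 subrr mulr0 oppr0 expR0 lerDl.
  by apply: sumr_ge0 => i _; exact: expR_ge0.
have key l : wsum one l (fun w => (stopping r (delta / D) w)%:R *
              (missing p w M * (1 - th)^-1 / weight p w)) <=
   2 * (1 - th)^-1 / c1 * (delta `^ t)^-1 * expR (- y) * G ^+ l.
  rewrite -wsum1.
  have -> : wsum g l (fun=> 1) = wsum one l (fun w => weight g w * 1).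
    by rewrite wsum_weight; congr (wsum _ l _); apply/funext => i; rewrite mul1r.
  rewrite -wsumZ; apply: le_wsum => // w _; rewrite mulr1.
  case: (boolP (stopping r (delta / D) w)) => [cw|_]; last first.
    rewrite mul0r !mulr_ge0 ?invr_ge0 ?expR_ge0 ?(ltW th1') ?(ltW c10) ?(ltW dt0)//.
    by rewrite /weight prodr_ge0.
  rewrite mul1r.
  have pw0 : 0 < weight p w by exact: weight_gt0.
  have sw := stopping_weight d0 rho1 cw; rewrite -/c1 in sw.
  have lw := weight_ge1 w lam1.
  have s0 : 0 <= \sum_(i <- w) (lam i - 1).
    by apply: sumr_ge0 => j _; rewrite subr_ge0.
  have pw : c1 * delta `^ t <= weight p w.
    apply: le_trans sw; rewrite ler_peMr// ?mulr_ge0 ?(ltW c10) ?(ltW dt0)//.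
    by apply: le_trans lw; rewrite lerDl.
  have mw : missing p w M <= 2 * (expR (- y) * weight g w).
    apply: (le_trans (missing_exp p0 p1 M pth th1 _)).
      rewrite pw0 /weight prodr_ile1// => i; rewrite p0 -p1 (bigD1 i)//= lerDl.
      by rewrite sumr_ge0.
    rewrite ler_pM2l// /g weight_expR -expRD ler_expR -opprD lerN2 -cE.
    apply: (@le_trans _ _ (c * (c1 * delta `^ t * weight lam w) * X)).
      rewrite /X (_ : _ * (y / _) = y * weight lam w); last first.
        by field; rewrite !gt_eqF.
      by rewrite -[X in X + _]mulr1 -mulrDr ler_wpM2l.
    apply: ler_pM; rewrite ?(ltW hM)//.
      by rewrite !mulr_ge0 ?(ltW c0) ?(ltW c10) ?(ltW dt0)// ltW// weight_gt0// => i; exact: lt_le_trans (lam1 i).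
    by rewrite ler_pM2l.
  rewrite ler_pdivrMr//.
  have gw0 : 0 <= weight g w by rewrite /weight prodr_ge0.
  apply: (@le_trans _ _ (2 * (expR (- y) * weight g w) * (1 - th)^-1)).
    by rewrite ler_wpM2r// invr_ge0 ltW.
  apply: (@le_trans _ _ (2 * (expR (- y) * weight g w) * (1 - th)^-1 *
       ((c1 * delta `^ t)^-1 * weight p w))).
    rewrite ler_peMr ?mulr_ge0 ?expR_ge0 ?invr_ge0 ?(ltW th1')//.
    by rewrite mulrC ler_pdivlMr ?mul1r// mulr_gt0.
  rewrite le_eqVlt; apply/orP; left; apply/eqP.
  by field; rewrite !gt_eqF.
have sumkey : \sum_(l < L.+1) wsum one l (fun w => (stopping r (delta / D) w)%:R *
              (missing p w M * (1 - th)^-1 / weight p w)) <=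
   2 * (1 - th)^-1 / c1 * (delta `^ t)^-1 * expR (- y) * G ^+ L * L.+1%:R.
  rewrite mulr_natr -[X in _ *+ X]card_ord -sumr_const.
  apply: ler_sum => l _; apply: (le_trans (key l)).
  rewrite ler_wpM2l// ?mulr_ge0 ?expR_ge0 ?invr_ge0 ?(ltW th1') ?(ltW c10) ?(ltW dt0)//.
  by apply: ler_weXn2l => //; rewrite -ltnS.
apply: (le_trans (lerD hM1 sumkey)).
have dt1 : delta `^ t <= 1.
  by rewrite -(powRr0 delta); apply: ger_powR; rewrite ?d0 ?(ltW d1).
have i1 : 1 <= (delta `^ t)^-1 by rewrite invf_ge1.
apply: (@le_trans _ _ (X + (delta `^ t)^-1 + 2 * (1 - th)^-1 / c1 * (delta `^ t)^-1 * expR (- y) * G ^+ L * L.+1%:R)).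
  by rewrite lerD2r lerD2l.
rewrite le_eqVlt; apply/orP; left; apply/eqP; rewrite /X -/G.
by field; rewrite !gt_eqF.
Qed.
End UpperBound.

(** * The exponent t and the two cases *)

Section RealFacts.
Context {R : realType}.
Implicit Types x y t : R.

Lemma ln_le_id x : 0 < x -> ln x <= x.
Proof.
move=> x0; have -> : x = 1 + (x - 1) by rewrite addrC subrK.
by apply: (le_trans (le_ln1Dx _)); lra.
Qed.

Lemma le_expR_id x : x <= expR x.
Proof. by apply: le_trans (expR_ge1Dx x); rewrite lerDr. Qed.

Lemma powR_expn x t n : 0 <= x -> (x ^+ n) `^ t = (x `^ t) ^+ n.
Proof.
move=> x0; elim: n => [|n IH]; first by rewrite !expr0 powR1.
by rewrite !exprS powRM ?exprn_ge0// IH.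
Qed.

Lemma level_choice (a D l0 : R) : 0 < a < 1 -> 1 <= D -> 0 < l0 ->
  exists2 K : R, 0 < K & forall delta, 0 < delta < 1 -> l0 <= ln delta^-1 ->
    exists2 L : nat, a ^+ L <= delta / D & L.+1%:R <= K * ln delta^-1.
Proof.
move=> /andP[a0 a1] D1 l00; pose b := - ln a.
have b0 : 0 < b by rewrite oppr_gt0 ln_lt0// a0.
have D0 : 0 < D by exact: lt_le_trans D1.
have lD : 0 <= ln D by exact: ln_ge0.
exists ((ln D / l0 + 1) / b + 2 / l0).
  by rewrite addr_gt0 ?divr_gt0// ltr_wpDl// divr_ge0// ltW.
move=> delta /andP[d0 d1]; set La := ln delta^-1 => hl.
have La0 : 0 < La by exact: lt_le_trans hl.
have dE : ln delta = - La by rewrite /La lnV ?posrE// opprK.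
pose X := (ln D + La) / b.
have X0 : 0 <= X by rewrite divr_ge0 ?addr_ge0// ltW.
exists (Num.truncn X).+1.
  rewrite -ler_ln ?posrE ?exprn_gt0 ?divr_gt0// lnXn// ln_div ?posrE// dE.
  have : X < (Num.truncn X).+1%:R by exact: truncnS_gt.
  rewrite ltr_pdivrMr// /b mulrN mulr_natl; lra.
have h : (Num.truncn X)%:R <= X by rewrite truncn_le.
rewrite -2!natr1.
apply: (@le_trans _ _ (X + 2)); first lra.
have l1 : 1 <= La / l0 by rewrite ler_pdivlMr// mul1r.
have -> : ((ln D / l0 + 1) / b + 2 / l0) * La =
   (ln D * (La / l0) + La) / b + 2 * (La / l0) by ring.
apply: lerD; last by rewrite ler_peMr.
by rewrite ler_pM2r ?invr_gt0// lerD2r ler_peMr.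
Qed.

Lemma max_of_ge N (f : 'I_N.+1 -> R) i : f i <= max_of f.
Proof. by rewrite /max_of; apply: le_bigmax_cond. Qed.

Lemma max_of_attained N (f : 'I_N.+1 -> R) : exists i, f i = max_of f.
Proof.
rewrite /max_of; elim/big_ind: _ => [|x y [i <-] [j <-]|i _].
- by exists ord0.
- by case: (leP (f i) (f j)) => _; [exists j|exists i].
- by exists i.
Qed.

Lemma lt_min_of N (f : 'I_N.+1 -> R) x i : x < min_of f -> x < f i.
Proof. by move=> /lt_le_trans; apply; rewrite /min_of; apply: bigmin_le_cond. Qed.

End RealFacts.

Section Exponents.
Context {R : realType} {d N : nat}.
Notation I := 'I_N.+1.
Variables (S : I -> 'rV[R]_d -> 'rV[R]_d) (r p : I -> R) (F : set 'rV[R]_d).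
Variable P : probability (codeSpace N) R.
Hypothesis hN : (0 < N)%N.
Hypothesis hS : forall i, similitude (S i) (r i).
Hypothesis hF : is_attractor S F.
Hypothesis hp : nondegenerate_probability_vector p.
Hypothesis hP : bernoulli_measure p P.

Definition exponent i := ln (p i) / ln (r i).
Let T := exponent.
Let t := max_of T.

Let r0 i : 0 < r i. Proof. by have [/andP[]] := hS i. Qed.
Let r1 i : r i < 1. Proof. by have [/andP[]] := hS i. Qed.
Let p0 i : 0 < p i. Proof. by have [] := hp. Qed.

Lemma p_lt1 i : p i < 1.
Proof.
have [_ <-] := hp; pose j := if i == ord0 then ord_max else ord0 : I.
have ji : j != i.
  rewrite /j; case: (eqVneq i ord0) => [->|]; last by rewrite eq_sym.
  by rewrite -val_eqE /= -lt0n.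
rewrite (bigD1 i)//= (bigD1 j)//= ltrDl ltr_pwDl// sumr_ge0// => k _.
exact: ltW.
Qed.

Lemma p_powR i : p i = r i `^ T i.
Proof.
rewrite /powR gt_eqF// /T /exponent divfK ?lnK ?posrE//.
by rewrite lt_eqF// ln_lt0// r0 r1.
Qed.

Lemma exponent_gt0 i : 0 < T i.
Proof.
rewrite /T /exponent -mulrNN -invrN divr_gt0// oppr_gt0 ln_lt0 ?p0 ?p_lt1//.
by rewrite r0 r1.
Qed.

Lemma t_gt0 : 0 < t.
Proof. by apply: lt_le_trans (exponent_gt0 ord0) _; exact: max_of_ge. Qed.

Let ltr_pow i x y : (r i `^ x < r i `^ y) = (y < x).
Proof.
rewrite /powR !gt_eqF// ltr_expR ltr_nM2r//.
by rewrite ln_lt0// r0 r1.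
Qed.

Let ler_pow i x y : (r i `^ x <= r i `^ y) = (y <= x).
Proof. by rewrite leNgt ltr_pow -leNgt. Qed.

Section SimilarityDimension.
Variable s : R.
Hypothesis hs : is_similarity_dimension r s.

Lemma similarity_dimension_le : s <= t.
Proof.
have [_ s1] := hs; have [_ p1] := hp.
rewrite leNgt; apply/negP => ts.
suff : \sum_i r i `^ s < \sum_i p i by rewrite s1 p1 ltxx.
apply: ltr_sum => [|i _]; first by apply/hasP; exists ord0; rewrite ?mem_index_enum.
by rewrite p_powR ltr_pow (le_lt_trans _ ts)// max_of_ge.
Qed.

Lemma similarity_dimension_eq : t = s <-> (forall i, p i = r i `^ s).
Proof.
have [_ s1] := hs; have [_ p1] := hp; split => [ts i|ps].
  have h j : 0 <= p j - r j `^ s.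
    by rewrite subr_ge0 p_powR ler_pow -ts max_of_ge.
  have : \sum_j (p j - r j `^ s) = 0 by rewrite sumrB p1 s1 subrr.
  move=> /eqP; rewrite psumr_eq0// => /allP /(_ i).
  by rewrite mem_index_enum subr_eq0 => /(_ isT) /eqP.
have [i Ti] := max_of_attained T; rewrite /t -Ti.
rewrite /T /exponent ps ln_powR mulfK// lt_eqF// ln_lt0//.
by rewrite r0 r1.
Qed.
End SimilarityDimension.

Let lam i := p i * r i `^ (- t).

Lemma lamE i : lam i = r i `^ (T i - t).
Proof. by rewrite /lam p_powR -powRD// (gt_eqF (r0 i)) implybT. Qed.

Lemma lam_ge1 i : 1 <= lam i.
Proof. by rewrite lamE -(powRr0 (r i)) ler_pow subr_le0 max_of_ge. Qed.

Lemma lam_gt1 i : T i != t -> 1 < lam i.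
Proof.
by move=> Tt; rewrite lamE -(powRr0 (r i)) ltr_pow subr_lt0 lt_neqAle Tt max_of_ge.
Qed.

Lemma lam_eq1 i : T i = t -> lam i = 1.
Proof. by move=> Tt; rewrite lamE Tt subrr powRr0. Qed.

Lemma upper_setup : exists K1 K2 K : R, [/\ 0 < K1, 0 < K2, 0 < K &
  forall v delta, F v -> 0 < delta < min_of r -> exists L : nat,
    [/\ L.+1%:R <= K * ln delta^-1, 0 < ln delta^-1 &
    forall y, 0 <= y -> (expected_waiting_time S F P delta v <=
      (delta `^ (- t) * (1 + K1 * y + K2 * L.+1%:R * expR (- y) *
         (\sum_i expR (- (y * (lam i - 1)))) ^+ L))%:E)%E]].
Proof.
have [_ Fc _] := hF.
have [D D1 hD] := compact_eucl_bounded Fc.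
pose th := \big[Num.max/0]_i p i.
have pth i : p i <= th by exact: le_bigmax_cond.
have th1 : th < 1 by apply/bigmax_ltP; split => // i _; exact: p_lt1.
have [i0 Ti0] := max_of_attained T.
have ex1 : exists i, lam i = 1 by exists i0; exact: lam_eq1.
have [K1 [K2 [K10 K20 hK]]] :=
  upper_parameter hS hF hp hP D1 hD (ltW t_gt0) lam_ge1 pth th1 ex1.
have l00 : 0 < ln (r ord0)^-1 by rewrite ln_gt0// invf_gt1.
have rm : 0 < rmax r < 1 by rewrite (rmax_gt0 hS) (rmax_lt1 hS).
have [K K0 hL] := level_choice rm D1 l00.
exists K1, K2, K; split => // v delta Fv /andP[d0 dm].
have dr := lt_min_of ord0 dm.
have d01 : 0 < delta < 1 by rewrite d0 (lt_trans dr).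
have hl : ln (r ord0)^-1 <= ln delta^-1.
  by rewrite ler_ln ?posrE ?invr_gt0// lef_pV2 ?posrE// ltW.
have [L rL LK] := hL _ d01 hl.
exists L; split => //; first exact: lt_le_trans hl.
by move=> y y0; exact: hK.
Qed.

(** Here [y] is a large multiple of [L], so that [expR (- y)] beats the number of
    words of length at most [L]. *)
Lemma upper_log : exists2 C : R, 0 < C &
  forall v, F v -> forall delta, 0 < delta < min_of r ->
    (expected_waiting_time S F P delta v <=
      (C * delta `^ (- t) * ln delta^-1)%:E)%E.
Proof.
have [K1 [K2 [K [K10 K20 K0 hK]]]] := upper_setup.
(* [expR (- y)] with [y = a * L.+1] absorbs both [L.+1] and [N.+1 ^ L]. *)
pose a : R := 1 + ln N.+1%:R.
have a1 : 1 <= a by rewrite lerDl ln_ge0// ler1n.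
exists ((1 + K1 * a + K2) * K); first by rewrite mulr_gt0// !addr_gt0 ?mulr_gt0// (lt_le_trans _ a1).
move=> v Fv delta dd; have [L [LK La0 hE]] := hK _ _ Fv dd.
have a0 : 0 <= a by exact: le_trans a1.
have y0 : 0 <= L.+1%:R * a by rewrite mulr_ge0.
apply: (le_trans (hE _ y0)); rewrite lee_fin.
set G := \sum_i _.
have G0 : 0 <= G by apply: sumr_ge0 => i _; exact: expR_ge0.
have GN : G <= N.+1%:R.
  rewrite -[N.+1 in leRHS]card_ord -sumr_const; apply: ler_sum => i _.
  rewrite -[leRHS]expR0 ler_expR oppr_le0; apply: (mulr_ge0 y0).
  by rewrite subr_ge0 lam_ge1.
have GL : expR (- (L.+1%:R * a)) * G ^+ L <= expR (- L.+1%:R).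
  apply: (@le_trans _ _ (expR (- (L.+1%:R * a)) * N.+1%:R ^+ L.+1)).
    rewrite ler_wpM2l ?expR_ge0//.
    apply: (@le_trans _ _ (N.+1%:R ^+ L)); first by rewrite lerXn2r ?nnegrE.
    by apply: ler_weXn2l => //; rewrite ler1n.
  rewrite -[X in _ * X ^+ _]lnK ?posrE// -expRM_natl -expRD ler_expR /a.
  by rewrite le_eqVlt; apply/orP; left; apply/eqP; ring.
have Le : L.+1%:R * expR (- L.+1%:R) <= 1 :> R.
  by rewrite expRN ler_pdivrMr ?expR_gt0// mul1r le_expR_id.
have dt : 0 <= delta `^ (- t) by exact: powR_ge0.
have L1 : 1 <= L.+1%:R :> R by rewrite ler1n.
rewrite [leRHS]mulrAC [leRHS]mulrC ler_wpM2l//.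
apply: (@le_trans _ _ ((1 + K1 * a + K2) * L.+1%:R)); last first.
  rewrite -mulrA ler_pM2l// !addr_gt0 ?mulr_gt0// (lt_le_trans _ a1)//.
have h2 : K2 * L.+1%:R * expR (- (L.+1%:R * a)) * G ^+ L <= K2.
  rewrite -!mulrA ler_piMr ?(ltW K20)//; apply: le_trans Le.
  by rewrite ler_wpM2l.
have h3 : K2 <= K2 * L.+1%:R by rewrite ler_peMr// ltW.
move: L1 h2 h3; set E := K2 * _ * _ * _; set l := L.+1%:R => L1 h2 h3.
by rewrite !mulrDl mul1r (mulrC l a) mulrA; lra.
Qed.

(** Every letter but [i0] costs a factor [expR (- y * eta)]. With [y] a large
    multiple of [ln L], this is at most [1 / L.+1], so the sum over the letters is
    [1 + O(1 / L)] and its power [L] stays bounded. *)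
Lemma upper_loglog : (exists! i, T i = t) -> exists2 C : R, 0 < C &
  forall v, F v -> forall delta, 0 < delta < min_of r ->
    (expected_waiting_time S F P delta v <=
      (C * delta `^ (- t) * loglog_sq delta)%:E)%E.
Proof.
move=> [i0 [Ti0 i0u]].
have [K1 [K2 [K [K10 K20 K0 hK]]]] := upper_setup.
pose eta := \big[Num.min/1]_(i | i != i0) (lam i - 1).
have eta0 : 0 < eta.
  apply/bigmin_gtP; split => // i ii0; rewrite subr_gt0 lam_gt1//.
  by apply: contra_neq ii0 => /i0u.
have eta_le i : i != i0 -> eta <= lam i - 1 by move=> h; exact: bigmin_le_cond.
(* With [y = a * ln L.+1] both [expR (- y)] and [expR (- y * eta)] are at most
   [1 / L.+1]. *)
pose a := 1 + eta^-1.
have a0 : 0 < a by rewrite addr_gt0// invr_gt0.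
pose C := 1 + K1 * a * (`|ln K| + 1) + K2 * expR N%:R.
have C0 : 0 < C.
  have k0 : 0 < `|ln K| + 1 by rewrite ltr_wpDl.
  by rewrite /C !addr_gt0// ?mulr_gt0// expR_gt0.
exists C => // v Fv delta dd; have [L [LK La0 hE]] := hK _ _ Fv dd.
have l0 : 0 <= ln L.+1%:R :> R by rewrite ln_ge0// ler1n.
have L0 : 0 < L.+1%:R :> R by [].
have y0 : 0 <= a * ln L.+1%:R by rewrite mulr_ge0// ltW.
apply: (le_trans (hE _ y0)); rewrite lee_fin.
set y := a * _ in y0 *.
set G := \sum_i _.
have ey : expR (- y) <= L.+1%:R^-1.
  rewrite expRN lef_pV2 ?posrE ?expR_gt0// -[leLHS]lnK ?posrE// ler_expR.
  by rewrite ler_peMl// lerDl invr_ge0 ltW.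
have eyeta : expR (- (y * eta)) <= L.+1%:R^-1.
  rewrite expRN lef_pV2 ?posrE ?expR_gt0// -[leLHS]lnK ?posrE// ler_expR.
  rewrite /y mulrAC ler_peMl// /a mulrDl mulVf ?gt_eqF// lerDr mul1r.
  exact: ltW.
have G0 : 0 <= G by apply: sumr_ge0 => i _; exact: expR_ge0.
have GN : G <= expR (N%:R / L.+1%:R).
  apply: le_trans (expR_ge1Dx _).
  rewrite /G (bigD1 i0)//= (lam_eq1 Ti0) subrr mulr0 oppr0 expR0 lerD2l.
  apply: (@le_trans _ _ (\sum_(i < N.+1 | i != i0) L.+1%:R^-1)).
    apply: ler_sum => i ii0; apply: le_trans eyeta.
    by rewrite ler_expR lerN2 ler_wpM2l// eta_le.
  rewrite sumr_const mulr_natl; have := cardC1 i0; rewrite card_ord /= => cN.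
  by rewrite (_ : #|_| = N)// -[RHS]cN; apply: eq_card => i; rewrite !inE.
have GL : G ^+ L <= expR N%:R.
  apply: (@le_trans _ _ (expR (N%:R / L.+1%:R) ^+ L)).
    by rewrite lerXn2r ?nnegrE ?expR_ge0.
  rewrite -expRM_natl ler_expR mulrCA ler_piMr//.
  by rewrite ler_pdivrMr// mul1r ler_nat.
have dt : 0 <= delta `^ (- t) by exact: powR_ge0.
rewrite [leRHS]mulrAC [leRHS]mulrC ler_wpM2l//.
have m1 : 1 <= loglog_sq delta by rewrite le_max lexx.
have lnL : ln L.+1%:R <= (`|ln K| + 1) * loglog_sq delta.
  apply: (@le_trans _ _ (ln K + ln (ln delta^-1))).
    by rewrite -lnM ?posrE// ler_ln ?posrE ?mulr_gt0.
  rewrite mulrDl mul1r; apply: lerD.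
    by apply: (le_trans (ler_norm _)); rewrite ler_peMr.
  have [h|h] := leP (ln (ln delta^-1)) 1; first exact: le_trans m1.
  rewrite le_max; apply/orP; right.
  by rewrite expr2 ler_peMl// ltW// (lt_trans _ h).
have h2 : K2 * L.+1%:R * expR (- y) * G ^+ L <= K2 * expR N%:R.
  apply: ler_pM => //; rewrite ?mulr_ge0 ?expR_ge0 ?exprn_ge0 ?(ltW K20)//.
  rewrite -mulrA ler_piMr ?(ltW K20)// mulrC -ler_pdivlMr// mul1r//.
have h1 : K1 * y <= K1 * a * (`|ln K| + 1) * loglog_sq delta.
  by rewrite -!mulrA ler_pM2l// ler_pM2l.
have e0 : 0 <= K2 * expR N%:R by rewrite mulr_ge0 ?expR_ge0// ltW.
rewrite /C !mulrDl mul1r.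
apply: lerD; first by apply: lerD.
by apply: (le_trans h2); rewrite ler_peMr.
Qed.

End Exponents.

Section LowerCases.
Context {R : realType} {d N : nat}.
Notation I := 'I_N.+1.
Variables (S : I -> 'rV[R]_d -> 'rV[R]_d) (r p : I -> R) (F : set 'rV[R]_d).
Variable P : probability (codeSpace N) R.
Hypothesis hN : (0 < N)%N.
Hypothesis hS : forall i, similitude (S i) (r i).
Hypothesis hOSC : open_set_condition S.
Hypothesis hF : is_attractor S F.
Hypothesis hp : nondegenerate_probability_vector p.
Hypothesis hP : bernoulli_measure p P.

Let T := exponent r p.
Let t := max_of T.

Let r0 i : 0 < r i. Proof. by have [/andP[]] := hS i. Qed.
Let r1 i : r i < 1. Proof. by have [/andP[]] := hS i. Qed.
Let p0 i : 0 < p i. Proof. by have [] := hp. Qed.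
Let t0 : 0 <= t. Proof. exact: ltW (t_gt0 hN hS hp). Qed.

Let rt i : T i = t -> r i `^ t = p i.
Proof. by move=> <-; rewrite -(p_powR hS hp). Qed.

Let ratio_lt1 i j : 0 < r i * r j < 1.
Proof. by rewrite mulr_gt0//= mulr_ilt1// ltW. Qed.

(** Concatenations of [k.+1] blocks [ij] or [ji]: exponentially many words, each
    of them as rare as possible for its ratio. *)
Lemma lower_log i j : i != j -> T i = t -> T j = t ->
  exists2 C : R, 0 < C & forall v, F v -> forall delta, 0 < delta < 1 ->
    ((C^-1 * delta `^ (- t) * ln delta^-1)%:E <=
       expected_waiting_time S F P delta v)%E.
Proof.
move=> ij Ti Tj.
pose th := r i * r j.
have th01 : 0 < th < 1 by exact: ratio_lt1.
have /andP[th0 th1] := th01.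
have tht : th `^ t = p i * p j by rewrite powRM ?(ltW (r0 _))// !rt.
have pp0 : 0 < p i * p j by rewrite mulr_gt0.
pose h k : R := ln ((2 ^ k.+1)%N%:R / (2 * (2 * k.+1))%N%:R).
apply: (lower_asymptotics hS hOSC hF hp hP (g := id) (h := h) th01 th0 pp0 t0) => //.
- move=> k.
  have uB : uniq [:: [:: i; j]; [:: j; i]].
    by rewrite /= !inE eqseq_cons (negPf ij).
  have hB : {in [:: [:: i; j]; [:: j; i]], forall b,
      [/\ size b = 2, weight p b = p i * p j & weight r b = th]}.
    move=> b; rewrite !inE => /orP[] /eqP ->; rewrite !weight_cons !weight_nil !mulr1//.
    by rewrite mulrC [r j * _]mulrC.
  have [A [uA sA hA]] := block_power k.+1 uB hB.
  exists A, (2 * k.+1)%N, ((p i * p j) ^+ k.+1), (th ^+ k.+1).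
  split => //; first by rewrite exprS.
  rewrite sA; split; last exact: lexx.
  by rewrite exprn_gt0//= powR_expn ?(ltW th0)// tht exprS.
- move=> kappa kappa0.
  have ln2 : 0 < ln 2 :> R by rewrite ln_gt0// ltr1n.
  (* From [ln x <= x] at [x = e * k.+1], the term [ln k.+1] takes away at most
     half of [k.+1 * ln 2]. *)
  pose e : R := ln 2 / 2; have e0 : 0 < e by rewrite divr_gt0.
  pose B : R := `|ln (4 / e)|.
  exists (2 * B / (kappa * e)), (kappa * e / 2); split.
    by rewrite divr_gt0// mulr_gt0.
  move=> L k; rewrite ler_pdivrMr ?mulr_gt0// => hL hk.
  have x0 : 0 < k.+1%:R :> R by rewrite ltr0n.
  have hE : h k = k.+1%:R * ln 2 - (ln (e * k.+1%:R) + ln (4 / e)).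
    rewrite /h ln_div ?posrE ?ltr0n ?expn_gt0// natrX lnXn// mulr_natl.
    have e4 : 0 < 4 / e by rewrite divr_gt0.
    have ek : 0 < e * k.+1%:R by rewrite mulr_gt0.
    congr (_ - _); rewrite -lnM ?posrE//; congr (ln _).
    by rewrite !natrM; field; rewrite gt_eqF.
  have l1 := ln_le_id (mulr_gt0 e0 x0).
  have l2 : ln (4 / e) <= B by exact: ler_norm.
  have k1 : kappa * L * e <= k.+1%:R * e.
    by rewrite ler_pM2r// (le_trans hk)// ler_nat.
  have ee : ln 2 = 2 * e by rewrite /e mulrC divfK.
  by rewrite hE ee; lra.
Qed.

(** Pairs of blocks of length [k.+1], each with one letter [j] among letters [i]:
    there are [k.+1 ^ 2] words of length [2 * k.+1], and their two letters [j]
    cost a constant factor only. A single [j] would give no more words than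
    letters, hence no logarithm. *)
Lemma lower_loglog i j : i != j -> T i = t ->
  exists2 C : R, 0 < C & forall v, F v -> forall delta, 0 < delta < 1 ->
    ((C^-1 * delta `^ (- t) * ln (ln delta^-1))%:E <=
       expected_waiting_time S F P delta v)%E.
Proof.
move=> ij Ti.
pose th := r i * r i.
have th01 : 0 < th < 1 by exact: ratio_lt1.
have /andP[th0 th1] := th01.
have tht : th `^ t = p i * p i by rewrite powRM ?(ltW (r0 _))// !rt.
have rj0 : 0 < r j ^+ 2 by rewrite exprn_gt0.
have pj0 : 0 < p j ^+ 2 by rewrite exprn_gt0.
pose h k : R := ln (k.+1%:R / 4).
apply: (lower_asymptotics hS hOSC hF hp hP (g := @ln R) (h := h) th01 rj0 pj0 t0).
- move=> k.
  pose blk a := nseq a i ++ j :: nseq (k - a) i.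
  pose B := [seq blk a | a <- iota 0 k.+1].
  have uB : uniq B.
    rewrite map_inj_uniq ?iota_uniq//; apply: (can_inj (g := index j)) => a.
    rewrite /blk index_cat mem_nseq eq_sym (negPf ij) andbF /= eqxx addn0.
    by rewrite size_nseq.
  have wn (x : 'I_N.+1 -> R) n : weight x (nseq n i) = x i ^+ n.
    by elim: n => [|n IH]; rewrite ?weight_nil// /= weight_cons IH exprS.
  have hB : {in B, forall b, [/\ size b = k.+1, weight p b = p i ^+ k * p j &
      weight r b = r i ^+ k * r j]}.
    move=> _ /mapP[a + ->]; rewrite mem_iota add0n ltnS => /= ak.
    rewrite size_cat /= !size_nseq !weight_cat !weight_cons !wn.
    have e (x : 'I_N.+1 -> R) : x i ^+ a * (x j * x i ^+ (k - a)) = x i ^+ k * x j.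
      by rewrite mulrCA -exprD subnKC// mulrC.
    by rewrite addnS subnKC// !e.
  have [A [uA sA hA]] := block_power 2 uB hB.
  exists A, (k.+1 * 2)%N, ((p i ^+ k * p j) ^+ 2), ((r i ^+ k * r j) ^+ 2).
  split => //.
    by rewrite /th exprMn exprMn; ring.
  split.
    rewrite exprn_gt0 ?mulr_gt0 ?exprn_gt0//= powR_expn ?(ltW th0)// tht.
    by rewrite le_eqVlt; apply/orP; left; apply/eqP; rewrite [in RHS]exprMn; ring.
  rewrite sA size_map size_iota /h le_eqVlt; apply/orP; left; apply/eqP; congr (ln _).
  by rewrite natrX !natrM; field; rewrite addrC natr1 pnatr_eq0.
- move=> kappa kappa0.
  exists (expR (- (2 * ln (kappa / 4)))), 2^-1; split; first by rewrite invr_gt0.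
  move=> L k hL hk.
  have L0 : 0 < L by apply: lt_le_trans hL; exact: expR_gt0.
  have lL : - (2 * ln (kappa / 4)) <= ln L.
    by rewrite -[leLHS]expRK ler_ln ?posrE ?expR_gt0.
  apply: (@le_trans _ _ (ln (kappa * L / 4))).
    rewrite mulrAC lnM ?posrE ?divr_gt0//; lra.
  rewrite /h ler_ln ?posrE ?divr_gt0 ?mulr_gt0// ler_pM2r ?invr_gt0//.
  by rewrite (le_trans hk)// ler_nat.
- move=> L L' L0 LL'; rewrite ler_ln ?posrE//; exact: lt_le_trans LL'.
Qed.
End LowerCases.

Theorem theorem1p1 (R : realType) (d N : nat)
    (S : 'I_N.+1 -> 'rV[R]_d -> 'rV[R]_d) (r p : 'I_N.+1 -> R)
    (F : set 'rV[R]_d) (s : R) (P : probability (codeSpace N) R)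
    (hN : (2 <= N.+1)%N)
    (hS : forall i, similitude (S i) (r i))
    (hOSC : open_set_condition S)
    (hF : is_attractor S F)
    (hs : is_similarity_dimension r s)
    (hp : nondegenerate_probability_vector p)
    (hP : bernoulli_measure p P) :
  let t := max_of (fun i => ln (p i) / ln (r i)) in
  [/\ s <= t,
      t = s <-> (forall i, p i = r i `^ s),
      (exists! i, ln (p i) / ln (r i) = t) ->
        exists2 C : R, 0 < C &
          forall v, F v -> forall delta : R, 0 < delta < min_of r ->
            ((C^-1 * delta `^ (- t) * ln (ln delta^-1))%:E
               <= expected_waiting_time S F P delta v)%E /\
            (expected_waiting_time S F P delta v
               <= (C * delta `^ (- t) * loglog_sq delta)%:E)%E
    & ~ (exists! i, ln (p i) / ln (r i) = t) ->
        exists2 C : R, 0 < C &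
          forall v, F v -> forall delta : R, 0 < delta < min_of r ->
            ((C^-1 * delta `^ (- t) * ln delta^-1)%:E
               <= expected_waiting_time S F P delta v)%E /\
            (expected_waiting_time S F P delta v
               <= (C * delta `^ (- t) * ln delta^-1)%:E)%E ].
Proof.
move=> t.
have N0 : (0 < N)%N by exact: hN.
have d01 delta : 0 < delta < min_of r -> 0 < delta < 1.
  move=> /andP[-> h]; have [/andP[_ r1] _] := hS ord0.
  by rewrite (lt_trans (lt_min_of ord0 h)).
(* A lower and an upper bound with constants C1 and C2 both hold with C1 + C2. *)
have combine (g1 g2 : R -> R) :
    (exists2 C : R, 0 < C & forall v, F v -> forall delta : R, 0 < delta < 1 ->
      ((C^-1 * delta `^ (- t) * g1 delta)%:E <=
        expected_waiting_time S F P delta v)%E) ->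
    (exists2 C : R, 0 < C & forall v, F v ->
      forall delta : R, 0 < delta < min_of r ->
      (expected_waiting_time S F P delta v <=
        (C * delta `^ (- t) * g2 delta)%:E)%E) ->
    (forall delta, 0 < delta < 1 -> 0 <= g2 delta) ->
    exists2 C : R, 0 < C &
      forall v, F v -> forall delta : R, 0 < delta < min_of r ->
        ((C^-1 * delta `^ (- t) * g1 delta)%:E
           <= expected_waiting_time S F P delta v)%E /\
        (expected_waiting_time S F P delta v
           <= (C * delta `^ (- t) * g2 delta)%:E)%E.
  move=> [C1 C10 h1] [C2 C20 h2] g20; exists (C1 + C2); first exact: addr_gt0.
  move=> v Fv delta dd; split; last first.
    apply: (le_trans (h2 v Fv delta dd)); rewrite lee_fin.
    rewrite ler_wpM2r ?g20 ?d01// ler_wpM2r ?powR_ge0//.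
    by rewrite lerDr ltW.
  have [g1n|g1p] := leP (g1 delta) 0.
    apply: le_trans (expected_waiting_time_ge1 delta hF Fv hP hp).
    rewrite lee_fin (le_trans (y := 0))// mulr_ge0_le0//.
    by rewrite mulr_ge0 ?powR_ge0// invr_ge0 addr_ge0 ?ltW.
  apply: le_trans (h1 v Fv delta (d01 _ dd)); rewrite lee_fin.
  rewrite ler_pM2r// ler_wpM2r ?powR_ge0// lef_pV2 ?posrE ?addr_gt0//.
  by rewrite lerDl ltW.
split.
- exact: (similarity_dimension_le hS hp hs).
- exact: (similarity_dimension_eq hS hp hs).
- move=> uniq_i; apply: combine.
  + have [i [Ti _]] := uniq_i.
    have [j ij] : exists j, i != j.
      exists (if i == ord0 then ord_max else ord0).
      case: (eqVneq i ord0) => [->|//].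
      by rewrite -val_eqE /= eq_sym -lt0n.
    exact: (lower_loglog N0 hS hOSC hF hp hP ij Ti).
  + exact: (upper_loglog N0 hS hF hp hP uniq_i).
  + by move=> delta _; rewrite /loglog_sq le_max ler01.
- move=> not_uniq; apply: combine.
  + have [i Ti] := max_of_attained (fun i => ln (p i) / ln (r i)).
    have [j ij Tj] : exists2 j, i != j & ln (p j) / ln (r j) = t.
      apply: contra_notP not_uniq => nj; exists i; split => // j Tj.
      by apply/eqP; apply: contra_notT nj => ij; exists j.
    exact: (lower_log N0 hS hOSC hF hp hP ij Ti Tj).
  + exact: (upper_log N0 hS hF hp hP).
  + by move=> delta /andP[d0 d1]; rewrite ln_ge0// invf_ge1// ltW.
Qed.
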